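(* Let $\theta\in(0,1)$ be irrational with $\theta^2=1/m$ for some $m\in\mathbb{N}_+$. For every $\varepsilon>0$, \[ \lim_{n\to\infty}\gamma_\theta\!\left(\left\{x\in[0,\theta]:\left|\frac{S_{n,\theta}(x)}{n\log n}-\frac{1}{\log(1+\theta^2)}\right|>\varepsilon\right\}\right)=0, \] i.e. $S_{n,\theta}/(n\log n)\to 1/\log(1+\theta^2)$ in $\gamma_\theta$-probability.
   Context: Let $m\in\mathbb{N}_+$ not be a perfect square and $\theta=1/\sqrt m\in(0,1)$ (so $\theta$ is irrational and $\theta^2=1/m$). The map $T_\theta:[0,\theta]\to[0,\theta]$ is $T_\theta(x)=\frac1x-\theta\lfloor\frac{1}{\theta x}\rfloor$ for $x\in(0,\theta]$ and $T_\theta(0)=0$. The digits of $x$ are $\ell_n(x)=\lfloor \frac{1}{\theta T_\theta^{n-1}(x)}\rfloor$ for $n\ge1$ (with $T_\theta^0(x)=x$); they take values in $\{m,m+1,\dots\}$ and are defined for almost every $x$ (e.g. all irrational $x\in(0,\theta]$). The probability measure $\gamma_\theta$ on $[0,\theta]$ has density $\frac{1}{\log(1+\theta^2)}\cdot\frac{\theta}{1+\theta x}$ with respect to Lebesgue measure; it is $T_\theta$-invariant and ergodic. Define $S_{n,\theta}(x)=\sum_{k=1}^n\ell_k(x)$. *)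

(* Defs.v *)
From HB Require Import structures.
From mathcomp Require Import all_boot all_order all_algebra.
From mathcomp Require Import all_classical all_reals all_analysis.
Set Implicit Arguments. Unset Strict Implicit. Unset Printing Implicit Defensive.
Import Order.TTheory GRing.Theory Num.Theory.
Local Open Scope classical_set_scope.
Local Open Scope ring_scope.

Definition Ttheta (R : realType) (theta : R) (x : R) : R :=
  if x == 0 then 0 else x^-1 - theta * (Num.floor ((theta * x)^-1))%:~R.

Definition digit (R : realType) (theta : R) (k : nat) (x : R) : int :=
  Num.floor ((theta * iter k.-1 (Ttheta theta) x)^-1).

Definition Ssum (R : realType) (theta : R) (n : nat) (x : R) : R :=
  \sum_(1 <= k < n.+1) (digit theta k x)%:~R.

Definition gamma_theta (R : realType) (theta : R) (A : set R) : \bar R :=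
  ((ln (1 + theta ^+ 2))^-1)%:E *
  (\int[@lebesgue_measure R]_(x in A `&` `[0%R, theta]%classic) (theta / (1 + theta * x))%:E)%E.

(* Main.v *)
(* Let P be the invariant probability and C = 1 / ln (1 + theta^2), so that
   P(l_k >= j) = C ln (1 + 1/j) for j >= m.  Truncate the digits at M = n K: the
   truncated mean is C ln M + O(1), and the probability that some l_k with k <= n
   exceeds M is at most about C / K.  By Chebyshev it remains to bound the
   correlations of the events {l_k >= j}, which are preimages under T^(k-1) of
   initial segments ]0, a].  The image under T of P restricted to ]0, a] has an
   increasing density with respect to P whose oscillation is at most 1/(m+1) < 1/2;
   writing this density as a mixture of indicators of initial segments and
   iterating, one gets
     |P(]0, a] /\ T^-k B) - P(]0, a]) P(B)| <= 2^-k P(B).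
   Hence the variance of the truncated sum is O(n M ln M), which is
   o((n ln n)^2), and K may then be taken large. *)

Require Import Defs.
From HB Require Import structures.
From mathcomp Require Import all_boot all_order all_algebra.
From mathcomp Require Import all_classical all_reals all_analysis.
From mathcomp Require Import measurable_realfun zify lra ring.
Set Implicit Arguments. Unset Strict Implicit. Unset Printing Implicit Defensive.
Import Order.TTheory GRing.Theory Num.Theory.
Import numFieldNormedType.Exports.
Local Open Scope classical_set_scope.
Local Open Scope ring_scope.

(** * Density measures and second moments of counts of events *)

Section density_measure.
Local Open Scope ereal_scope.
Context d (T : measurableType d) (R : realType).
Variables (mu : {measure set T -> \bar R}) (f : T -> R).

(** The proofs [mf] and [f0] are arguments so that the measure structure declared below can be
    inferred from the term itself. *)
Definition density_measure (mf : measurable_fun setT f)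
  (f0 : forall x, (0 <= f x)%R) (A : set T) : \bar R :=
  \int[mu]_(x in A) (f x)%:E.

Hypotheses (mf : measurable_fun setT f) (f0 : forall x, (0 <= f x)%R).

Let density0 : density_measure mf f0 set0 = 0.
Proof. by rewrite /density_measure integral_set0. Qed.

Let density_ge0 A : 0 <= density_measure mf f0 A.
Proof. by apply: integral_ge0 => x _; rewrite lee_fin. Qed.

Let density_sigma_additive : semi_sigma_additive (density_measure mf f0).
Proof.
move=> /= F mF tF mUF; rewrite /density_measure; apply: cvg_toP.
  apply: ereal_nondecreasing_is_cvgn => m n mn.
  apply: lee_sum_nneg_natr => // k _ _.
  by apply: integral_ge0 => /= x Fkx; rewrite lee_fin.
rewrite ge0_integral_bigcup//=.
- by apply/measurable_EFinP; apply: measurable_funTS.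
- by move=> x _; rewrite lee_fin.
Qed.

HB.instance Definition _ := isMeasure.Build _ _ _ (density_measure mf f0)
  density0 density_ge0 density_sigma_additive.

End density_measure.

Section real_probability.
Context d (T : measurableType d) (R : realType) (P : probability T R).

Lemma fine_prob_ge0 (A : set T) : 0 <= fine (P A).
Proof. by rewrite fine_ge0. Qed.

Lemma le_fine_prob (A B : set T) : measurable A -> measurable B -> A `<=` B ->
  fine (P A) <= fine (P B).
Proof.
by move=> mA mB AB; rewrite fine_le ?fin_num_measure// le_measure ?inE.
Qed.

Lemma fine_prob_le1 (A : set T) : measurable A -> fine (P A) <= 1.
Proof.
move=> mA; rewrite -[leRHS]/(fine 1%E) -(probability_setT P).
exact: le_fine_prob.
Qed.

Lemma fine_probU (A B : set T) : measurable A -> measurable B ->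
  A `&` B = set0 -> fine (P (A `|` B)) = fine (P A) + fine (P B).
Proof. by move=> mA mB AB; rewrite measureU// fineD ?fin_num_measure. Qed.

Lemma fine_probU2_le (A B : set T) : measurable A -> measurable B ->
  fine (P (A `|` B)) <= fine (P A) + fine (P B).
Proof.
move=> mA mB; rewrite -lee_fin EFinD !fineK ?fin_num_measure//.
  exact: measureU2.
exact: measurableU.
Qed.

Lemma fine_probDI (A B : set T) : measurable A -> measurable B ->
  fine (P A) = fine (P (A `&` B)) + fine (P (A `&` ~` B)).
Proof.
move=> mA mB; have mAB : measurable (A `\` B) by exact: measurableD.
have mAI : measurable (A `&` B) by exact: measurableI.
by rewrite -setDE (measureDI P mA mB) fineD ?fin_num_measure// addrC.
Qed.

Lemma fine_probI_null (A N : set T) : measurable A -> measurable N ->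
  P N = 0%E -> fine (P (A `&` ~` N)) = fine (P A).
Proof.
move=> mA mN N0; rewrite (fine_probDI mA mN).
have /= -> := @subset_measure0 _ _ _ P (A `&` N) N; rewrite ?add0r//.
exact: measurableI.
Qed.

Lemma integral_sum_indic (I : Type) (r : seq I) (a : I -> R) (B : I -> set T) :
  (forall i, 0 <= a i) -> (forall i, measurable (B i)) ->
  (\int[P]_x (\sum_(i <- r) a i * \1_(B i) x)%:E =
   (\sum_(i <- r) a i * fine (P (B i)))%:E)%E.
Proof.
move=> a0 mB; under eq_integral do rewrite -sumEFin.
rewrite ge0_integral_sum//=; last 2 first.
- move=> i; apply/measurable_EFinP; apply: measurable_funM => //.
- by move=> i x _; rewrite lee_fin mulr_ge0.
rewrite -sumEFin; apply: eq_bigr => i _.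
under eq_integral do rewrite EFinM.
have mBi : measurable_fun setT (fun x => (\1_(B i) x)%:E : \bar R).
  exact/measurable_EFinP/measurable_indic.
rewrite ge0_integralZl_EFin//.
by rewrite integral_indic// setIT EFinM fineK ?fin_num_measure.
Qed.

(* Expanding [t^2 <= (X - c)^2] and moving the cross term to the left leaves
   nonnegative functions only. *)
Lemma chebyshev_indic (I : finType) (A : I -> set T) (t : R) :
  (forall i, measurable (A i)) -> 0 < t ->
  measurable [set x | t <= `|\sum_i \1_(A i) x - \sum_i fine (P (A i))|] ->
  fine (P [set x | t <= `|\sum_i \1_(A i) x - \sum_i fine (P (A i))|]) <=
  t ^- 2 * \sum_i \sum_j
    (fine (P (A i `&` A j)) - fine (P (A i)) * fine (P (A j))).
Proof.
move=> mA t0; set c := \sum_i fine (P (A i)); set B := [set x | _] => mB.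
have c0 : 0 <= c by apply: sumr_ge0 => i _; exact: fine_prob_ge0.
have mAA (p : I * I) : measurable (A p.1 `&` A p.2) by exact: measurableI.
have mfI (U : set T) : measurable U -> measurable_fun setT (\1_U : T -> R).
  by move=> mU; exact: measurable_indic.
(* With X the sum of the indicators, [l] is the integral of t^2 1_B + 2 c X and [r] that of c^2 +
   X^2. The index [None] carries the first term of each, so that [integral_sum_indic] evaluates both
   sides. *)
pose l := (\int[P]_x (\sum_(o <- None :: map Some (index_enum I))
   (if o is Some i then 2 * c else t ^+ 2) *
   \1_(if o is Some i then A i else B) x)%:E)%E.
pose r := (\int[P]_x (\sum_(o <- None :: map Some (index_enum (I * I)%type))
   (if o is Some i then 1 else c ^+ 2) *
   \1_(if o is Some p then A p.1 `&` A p.2 else setT) x)%:E)%E.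
have lr : (l <= r)%E.
  apply: ge0_le_integral => //=.
  - move=> x _; rewrite lee_fin sumr_ge0// => -[i|] _.
      by rewrite mulr_ge0// mulr_ge0.
    by rewrite mulr_ge0// sqr_ge0.
  - apply/measurable_EFinP; apply: measurable_sum => o.
    by apply: measurable_funM => //; apply: mfI; case: o.
  - apply/measurable_EFinP; apply: measurable_sum => o.
    by apply: measurable_funM => //; apply: mfI; case: o.
  - move=> x _; rewrite lee_fin !big_cons !big_map/= indicT mulr1.
    rewrite -mulr_sumr.
    have -> : \sum_(p : I * I) 1 * \1_(A p.1 `&` A p.2) x =
              (\sum_i \1_(A i) x) ^+ 2 :> R.
      rewrite expr2 mulr_suml.
      under [RHS]eq_bigr do rewrite mulr_sumr.
      rewrite pair_big/=; apply: eq_bigr => p _.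
      by rewrite mul1r indicI.
    set X := \sum_i _.
    have [xB|xB] := pselect (B x).
      rewrite indicE mem_set// mulr1.
      have : t ^+ 2 <= (X - c) ^+ 2.
        by rewrite -[leRHS]real_normK ?num_real// lerXn2r// nnegrE// ltW.
      by rewrite sqrrB; lra.
    rewrite indicE memNset// mulr0.
    by have := sqr_ge0 (X - c); rewrite sqrrB; lra.
move: lr; rewrite /l /r !integral_sum_indic; last 4 first.
- by case=> [i|] //; exact: sqr_ge0.
- by case.
- by case=> [i|]; rewrite ?sqr_ge0// mulr_ge0.
- by case.
rewrite lee_fin !big_cons !big_map -mulr_sumr -/c => lr.
rewrite mulrC ler_pdivlMr ?exprn_gt0//.
have -> : \sum_i \sum_j
    (fine (P (A i `&` A j)) - fine (P (A i)) * fine (P (A j))) =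
    \sum_(p : I * I) 1 * fine (P (A p.1 `&` A p.2)) - c ^+ 2 :> R.
  under eq_bigr do rewrite sumrB -mulr_sumr.
  rewrite sumrB -mulr_suml pair_big/= expr2; congr (_ - _).
  by apply: eq_bigr => p _; rewrite mul1r.
by move: lr; rewrite probability_setT /= mulr1 expr2; lra.
Qed.

End real_probability.

(** * The map and its branches *)

Section gauss_map.
Variables (R : realType) (theta : R).
Local Notation T := (Ttheta theta).

(** Inversion is continuous off 0, and its value at 0 is 0 by convention. *)
Lemma measurable_invr : measurable_fun setT (@GRing.inv R).
Proof.
have op : open [set x : R | x != 0].
  have -> : [set x : R | x != 0] = ~` [set 0].
    by apply/seteqP; split => x /= /eqP.
  apply: closed_openC; exact: closed_eq.
have mi : measurable_fun [set x : R | x != 0] (@GRing.inv R).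
  apply: open_continuous_measurable_fun => // x /[!inE] /= xn0.
  exact: inv_continuous.
have -> : @GRing.inv R = (fun x => if x != 0 then x^-1 else 0).
  by apply/funext => x; case: eqP => //= ->; rewrite invr0.
apply: measurable_fun_if => //.
  apply: measurable_neg; apply: measurable_fun_eqr => //.
by rewrite setTI.
Qed.

Lemma measurable_floor :
  measurable_fun setT (fun x : R => (Num.floor x)%:~R : R).
Proof.
apply: nondecreasing_measurable => // x y xy.
by rewrite ler_int le_floor.
Qed.

Lemma measurable_Ttheta : measurable_fun setT T.
Proof.
apply: measurable_fun_ifT => //.
- exact: measurable_fun_eqr.
- apply: measurable_funB; first exact: measurable_invr.
  apply: measurable_funM => //.
  apply: (measurableT_comp measurable_floor).
  apply: (measurableT_comp measurable_invr).
  exact: measurable_funM.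
Qed.

Lemma measurable_iter_Ttheta k : measurable_fun setT (iter k T).
Proof.
elim: k => [|k IHk]; first exact: measurable_id.
exact: (measurableT_comp measurable_Ttheta IHk).
Qed.

Lemma measurable_preimage_iter k (B : set R) :
  measurable B -> measurable (iter k T @^-1` B).
Proof.
by move=> mB; rewrite -[X in measurable X]setTI; exact: measurable_iter_Ttheta.
Qed.

Hypothesis theta_gt0 : 0 < theta.

(** For x > 0, [T x] is [theta] times the fractional part of 1/(theta x). *)
Lemma Ttheta_itv x : 0 <= x -> 0 <= T x < theta.
Proof.
move=> x0; rewrite /Ttheta; case: eqP => [_|/eqP xn0].
  by rewrite lexx theta_gt0.
have xp : 0 < x by rewrite lt_def xn0.
have /andP[fl fu] := floor_itv (theta * x)^-1.
have e : x^-1 = theta * (theta * x)^-1.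
  by field; rewrite !gt_eqF.
rewrite e -mulrBr mulr_ge0 ?subr_ge0// ?(ltW theta_gt0)//=.
rewrite -[ltRHS]mulr1 ltr_pM2l// ltrBlDl (lt_le_trans fu)//.
by rewrite intrD.
Qed.

Lemma iter_Ttheta_itv k x : 0 <= x <= theta -> 0 <= iter k T x <= theta.
Proof.
move=> xt; elim: k => //= k /andP[k0 _].
by have /andP[-> /ltW ->] := Ttheta_itv k0.
Qed.

Lemma Ttheta_branch i (y : R) : (0 < i)%N ->
  (theta * i.+1%:R)^-1 < y <= (theta * i%:R)^-1 ->
  T y = y^-1 - theta * i%:R.
Proof.
move=> i0 /andP[ly yu].
have y0 : 0 < y by rewrite (le_lt_trans _ ly)// invr_ge0 mulr_ge0// ltW.
rewrite /Ttheta gt_eqF//; congr (_ - theta * _).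
have t1 : 0 < theta * i%:R by rewrite mulr_gt0// ltr0n.
have t2 : 0 < theta * i.+1%:R by rewrite mulr_gt0.
rewrite (@floor_def _ _ i%:Z)// -PoszD addn1 -!pmulrn invfM; apply/andP; split.
  rewrite -(ler_pM2l theta_gt0) mulrA divff ?gt_eqF// mul1r.
  by rewrite -[leLHS]invrK lef_pV2 ?posrE ?invr_gt0.
rewrite -(ltr_pM2l theta_gt0) mulrA divff ?gt_eqF// mul1r.
by rewrite -[ltRHS]invrK ltf_pV2 ?posrE ?invr_gt0.
Qed.

Lemma inv_branch_le i (t : R) : (0 < i)%N -> 0 < t -> t <= theta ->
  (theta * i.+1%:R)^-1 <= (theta * i%:R + t)^-1.
Proof.
move=> i0 t0 tt; have ti : 0 < theta * i%:R by rewrite mulr_gt0// ltr0n.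
have ti1 : 0 < theta * i.+1%:R by rewrite mulr_gt0.
by rewrite lef_pV2 ?posrE ?ti1 ?addr_gt0// -natr1 mulrDr mulr1 lerD2l.
Qed.

(** On branch [i], where the digit is [i], the map is decreasing and takes the value [t] at 1/(theta
    i + t). So the points of this branch sent below [t] form an interval, which is split off from
    the branches of larger index; it is empty when 1/(theta i + t) >= a. *)
Lemma Ttheta_slab i (a t : R) : (0 < i)%N ->
  (theta * i.+1%:R)^-1 < a <= (theta * i%:R)^-1 -> 0 < t <= theta ->
  `]0, a]%classic `&` T @^-1` `]-oo, t[%classic =
  `](theta * i%:R + t)^-1, a]%classic `|`
  (`]0, (theta * i.+1%:R)^-1]%classic `&` T @^-1` `]-oo, t[%classic).
Proof.
move=> i0 /andP[la au] /andP[t0 tt].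
have ti : 0 < theta * i%:R by rewrite mulr_gt0// ltr0n.
have lt := inv_branch_le i0 t0 tt.
have key y : (theta * i.+1%:R)^-1 < y <= a ->
    (T y < t) = ((theta * i%:R + t)^-1 < y).
  move=> /andP[ly ya]; rewrite (@Ttheta_branch i)//; last first.
    by rewrite ly (le_trans ya).
  have y0 : 0 < y by rewrite (le_lt_trans _ ly)// invr_ge0 mulr_ge0// ltW.
  by rewrite ltrBlDl -[X in _ = (_ < X)]invrK ltf_pV2 ?posrE ?addr_gt0 ?invr_gt0.
apply/seteqP; split => y /=; rewrite !in_itv/=.
  move=> [/andP[y0 ya] Ty]; have [yl|ly] := leP y (theta * i.+1%:R)^-1.
    by right; rewrite y0.
  by left; rewrite -key ?Ty ?ly.
move=> [/andP[ly ya]|[/andP[y0 yl] Ty]].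
  have ly' := le_lt_trans lt ly.
  split; last by rewrite key ?ly'.
  by rewrite ya andbT (le_lt_trans _ ly')// invr_ge0 mulr_ge0// ltW.
by rewrite y0 Ty (le_trans yl)// ltW.
Qed.

Lemma Ttheta_slab_disj i (a t : R) : (0 < i)%N -> 0 < t <= theta ->
  `](theta * i%:R + t)^-1, a]%classic `&`
  (`]0, (theta * i.+1%:R)^-1]%classic `&` T @^-1` `]-oo, t[%classic) = set0.
Proof.
move=> i0 /andP[t0 tt]; apply/seteqP; split => // y /=; rewrite !in_itv/=.
have lt := inv_branch_le i0 t0 tt.
move=> [/andP[ly _] [/andP[_ yl] _]].
by move: (lt_le_trans ly (le_trans yl lt)); rewrite ltxx.
Qed.

End gauss_map.

(** * Logarithmic integrals, the branch measures and the invariant measure *)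

Section integral_inv.
Variable R : realType.
Local Notation mu := (@lebesgue_measure R).

Lemma integral_invDl (b u v : R) : 0 < b + u -> u <= v ->
  (\int[mu]_(x in `[u, v]) ((b + x)^-1)%:E = (ln (b + v) - ln (b + u))%:E)%E.
Proof.
move=> bu; rewrite le_eqVlt => /predU1P[->|uv].
  by rewrite set_itv1 integral_set1 subrr.
have pos x : u <= x -> 0 < b + x by move=> ux; rewrite (lt_le_trans bu)// lerD2l.
have di x : u <= x -> is_derive x 1 (fun x => ln (b + x)) (b + x)^-1.
  move=> ux; have dl := is_derive1_ln (pos x ux).
  have db : is_derive x 1 (fun x => b + x) 1.
    by have := is_deriveD (is_derive_cst b x 1) (is_derive_id x 1); rewrite add0r.
  by have := is_derive1_comp dl db; rewrite mulr1.
have cF x : u <= x -> {for x, continuous (fun x => ln (b + x))}.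
  move=> ux; apply: differentiable_continuous; apply/derivable1_diffP.
  by have [] := di x ux.
rewrite (@continuous_FTC2 _ _ (fun x => ln (b + x)))//.
- apply: continuous_in_subspaceT => x /[!inE]/=; rewrite in_itv/= => /andP[ux _].
  apply: continuousV; first by rewrite gt_eqF ?pos.
  by apply: continuousD; [exact: cst_continuous|exact: cvg_id].
- split.
  + move=> x /[!in_itv]/= /andP[ux _]; have [] := di x (ltW ux) => //.
  + by apply: cvg_at_right_filter; exact: cF.
  + by apply: cvg_at_left_filter; apply: cF; exact: ltW.
- move=> x /[!in_itv]/= /andP[ux _].
  by rewrite derive1E; have [_ ->] := di x (ltW ux).
Qed.

End integral_inv.

Section gauss_measure.
Variables (R : realType) (theta : R) (m : nat).
Local Notation T := (Ttheta theta).
Local Notation mu := (@lebesgue_measure R).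

Definition gauss_const : R := (ln (1 + theta ^+ 2))^-1.
Local Notation C := gauss_const.

Lemma gauss_const_ge0 : 0 <= C.
Proof. by rewrite invr_ge0 ln_ge0// lerDl sqr_ge0. Qed.

(* The Lebesgue density of the image under [T] of the restriction of the invariant
   measure to the interval ]0, (theta j + s)^-1] (see [one_step]); [j = m], [s = 0] gives the
   density of the invariant measure itself, as [theta m = theta^-1]. *)
Definition branch_density (j : nat) (s x : R) : R :=
  if 0 <= x <= theta then C / (theta * (j + (x < s)%R)%:R + x) else 0.

Lemma branch_density_ge0 j s x : 0 <= branch_density j s x.
Proof.
rewrite /branch_density; case: ifPn => // /andP[x0 xt].
rewrite divr_ge0 ?gauss_const_ge0// addr_ge0// mulr_ge0//.
exact: le_trans xt.
Qed.

Lemma measurable_step (j : nat) (s : R) :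
  measurable_fun setT (fun x : R => (j + (x < s)%R)%:R : R).
Proof.
rewrite [X in measurable_fun _ X](_ : _ = fun x => if x < s then j.+1%:R else j%:R).
  by apply: measurable_fun_ifT => //; exact: measurable_fun_ltr.
by apply/funext => x; case: (x < s); rewrite ?addn1 ?addn0.
Qed.

Lemma measurable_branch_density j s :
  measurable_fun setT (branch_density j s).
Proof.
apply: measurable_fun_ifT => //.
  apply: measurable_and; exact: measurable_fun_ler.
apply: measurable_funM => //.
apply: (measurableT_comp (@measurable_invr R)).
by apply: measurable_funD => //; apply: measurable_funM => //; exact: measurable_step.
Qed.

Definition branch_measure (j : nat) (s : R) : set (measurableTypeR R) -> \bar R :=
  density_measure mu (measurable_branch_density j s) (branch_density_ge0 j s).

HB.instance Definition _ j s := Measure.on (branch_measure j s).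

(** The last hypothesis keeps [u, v[ on one side of the jump at [s], where the density is C/(b +
    x). *)
Lemma branch_measure_itv j s (b u v : R) : 0 < b + u -> 0 <= u -> u <= v -> v <= theta ->
  (forall x, u <= x < v -> theta * (j + (x < s)%R)%:R = b) ->
  branch_measure j s `[u, v[%classic = (C * (ln (b + v) - ln (b + u)))%:E.
Proof.
move=> bu u0 uv vt bE; rewrite /branch_measure /density_measure.
have mi : measurable_fun `[u, v]%classic (fun x => (b + x)^-1 : R).
  apply: measurable_funTS; apply: (measurableT_comp (@measurable_invr R)).
  exact: measurable_funD.
transitivity (\int[mu]_(x in `[u, v[) (C * (b + x)^-1)%:E)%E.
  apply: eq_integral => x /[!inE] /= /[!in_itv]/= /andP[ux xv].
  rewrite /branch_density ifT ?bE ?ux//.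
  by rewrite (le_trans u0 ux) (le_trans (ltW xv)).
rewrite integral_itv_bndo_bndc; last first.
  apply/measurable_EFinP; apply: measurable_funM => //.
  by apply: measurable_funS mi => //; exact: subset_itv_co_cc.
under eq_integral do rewrite EFinM.
rewrite ge0_integralZl_EFin//; last 3 first.
- move=> x /=; rewrite in_itv/= lee_fin invr_ge0 => /andP[ux _].
  by rewrite (le_trans (ltW bu))// lerD2l.
- exact/measurable_EFinP.
- exact: gauss_const_ge0.
by rewrite integral_invDl.
Qed.

Lemma branch_measure_oc j s (u v : R) :
  branch_measure j s `]u, v]%classic = branch_measure j s `[u, v[%classic.
Proof.
have mb D : measurable_fun D (EFin \o branch_density j s).
  by apply/measurable_EFinP; apply: measurable_funTS; exact: measurable_branch_density.
rewrite /branch_measure /density_measure integral_itv_obnd_cbnd//.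
by rewrite integral_itv_bndo_bndc.
Qed.

Lemma branch_measure_cc j s (u v : R) :
  branch_measure j s `[u, v]%classic = branch_measure j s `[u, v[%classic.
Proof.
rewrite /branch_measure /density_measure integral_itv_bndo_bndc//.
by apply/measurable_EFinP; apply: measurable_funTS; exact: measurable_branch_density.
Qed.

Lemma branch_measureI j s A :
  branch_measure j s (A `&` `[0, theta]%classic) = branch_measure j s A.
Proof.
rewrite /branch_measure /density_measure integral_mkcondr.
apply: eq_integral => x _; rewrite patchE; case: ifPn => //.
rewrite notin_setE/= in_itv/= /branch_density => /negP xt.
by rewrite (negbTE xt).
Qed.

Lemma branch_measure1 j s (x : R) : branch_measure j s [set x] = 0%E.
Proof. by rewrite /branch_measure /density_measure integral_set1. Qed.

Definition gauss_measure := branch_measure m 0.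
HB.instance Definition _ := Measure.on gauss_measure.
End gauss_measure.

(** * The invariant probability and the one-step image of an initial segment *)

Section gauss_prob.
Variables (R : realType) (theta : R) (m : nat).
Hypotheses (theta_gt0 : 0 < theta) (theta_sq : theta ^+ 2 = m%:R^-1).
Local Notation T := (Ttheta theta).
Local Notation C := (gauss_const theta).

Lemma theta_sq_m_gt0 : (0 < m)%N.
Proof.
(* As 0^-1 = 0, the value m = 0 would force theta = 0. *)
rewrite lt0n; apply/eqP => m0; move: theta_sq; rewrite m0 invr0 => /eqP.
by rewrite expf_eq0/= gt_eqF.
Qed.
Let m_gt0 := theta_sq_m_gt0.

Lemma theta_sq_mulm : theta * (theta * m%:R) = 1.
Proof. by rewrite mulrA -expr2 theta_sq mulVf// pnatr_eq0 -lt0n. Qed.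

Lemma theta_m_gt0 : 0 < theta * m%:R.
Proof. by rewrite mulr_gt0// ltr0n. Qed.

Lemma theta_inv : theta^-1 = theta * m%:R.
Proof.
by apply: (mulfI (lt0r_neq0 theta_gt0)); rewrite divff ?gt_eqF// theta_sq_mulm.
Qed.

Lemma ln1Dtheta_gt0 : 0 < ln (1 + theta ^+ 2).
Proof. by rewrite ln_gt0// ltrDl exprn_gt0. Qed.

Lemma gauss_const_gt0 : 0 < C.
Proof. by rewrite invr_gt0 ln1Dtheta_gt0. Qed.

(** The mass is [C] times the logarithm of (theta m + theta)/(theta m), and this quotient is 1 +
    theta^2. *)
Lemma gauss_measure_setT : gauss_measure theta m setT = 1%E.
Proof.
rewrite /gauss_measure -branch_measureI setTI branch_measure_cc.
rewrite (@branch_measure_itv _ _ _ _ (theta * m%:R))//; last 3 first.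
  by rewrite addr0 theta_m_gt0.
  exact: ltW.
  by move=> x /andP[x0 _]; rewrite ltNge x0 addn0.
rewrite addr0 -ln_div ?posrE ?theta_m_gt0// ?addr_gt0 ?theta_m_gt0//.
rewrite mulrDl divff ?gt_eqF ?theta_m_gt0// -theta_inv invrK -expr2.
by rewrite mulVf// gt_eqF// ln1Dtheta_gt0.
Qed.

Definition gauss_prob (t0 : 0 < theta) (tm : theta ^+ 2 = m%:R^-1) :
  set (measurableTypeR R) -> \bar R := gauss_measure theta m.

HB.instance Definition _ := Measure.on (gauss_prob theta_gt0 theta_sq).
HB.instance Definition _ := Measure_isProbability.Build _ _ _
  (gauss_prob theta_gt0 theta_sq) gauss_measure_setT.

Local Notation P := (gauss_prob theta_gt0 theta_sq).

(** Up to the factor [C] this is the mass of ]0, 1/z] when z >= theta m; at z = theta i it equals ln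
    (1 + 1/i). *)
Definition lnstep (z : R) : R := ln (z + theta) - ln z.

(** Since theta m = 1/theta, the primitive ln (theta m + x) at x = 1/y is [lnstep y] - ln theta, and
    ln theta cancels in the difference. The bound on [y] says that 1/y <= theta. *)
Lemma gauss_probE (y z : R) : theta * m%:R <= y -> y <= z ->
  fine (P `]z^-1, y^-1]%classic) = C * (lnstep y - lnstep z).
Proof.
move=> my yz.
have y0 : 0 < y by rewrite (lt_le_trans _ my)// theta_m_gt0.
have z0 : 0 < z by rewrite (lt_le_trans y0).
rewrite /gauss_prob /gauss_measure branch_measure_oc.
rewrite (@branch_measure_itv _ _ _ _ (theta * m%:R))//; last 5 first.
  by rewrite addr_gt0 ?theta_m_gt0// invr_gt0.
  by rewrite invr_ge0 ltW.
  by rewrite lef_pV2.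
  by rewrite -[leRHS]invrK lef_pV2 ?posrE ?invr_gt0// theta_inv.
  move=> x /andP[zx _]; rewrite ltNge (le_trans _ zx) ?addn0//.
  by rewrite invr_ge0 ltW.
rewrite /= /lnstep; congr (_ * _).
have e (x : R) : 0 < x -> theta * m%:R + x^-1 = (x + theta) / (x * theta).
  by move=> x0; rewrite -theta_inv; field; rewrite !gt_eqF.
rewrite !e// !ln_div ?posrE ?addr_gt0 ?mulr_gt0// !lnM ?posrE//; lra.
Qed.

Lemma gauss_prob0E (y : R) : theta * m%:R <= y ->
  fine (P `]0, y^-1]%classic) = C * lnstep y.
Proof.
move=> my.
have y0 : 0 < y by rewrite (lt_le_trans _ my)// theta_m_gt0.
rewrite /gauss_prob /gauss_measure branch_measure_oc.
rewrite (@branch_measure_itv _ _ _ _ (theta * m%:R))//; last 4 first.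
  by rewrite addr0 theta_m_gt0.
  by rewrite invr_ge0 ltW.
  by rewrite -[leRHS]invrK lef_pV2 ?posrE ?invr_gt0// theta_inv.
  by move=> x /andP[zx _]; rewrite ltNge zx addn0.
rewrite /= /lnstep addr0; congr (_ * _).
have -> : theta * m%:R + y^-1 = (y + theta) / (y * theta).
  by rewrite -theta_inv; field; rewrite !gt_eqF.
rewrite !ln_div ?posrE ?addr_gt0 ?mulr_gt0// !lnM ?posrE ?ltr0n//.
have := congr1 (@ln R) theta_sq_mulm.
rewrite !lnM ?posrE ?mulr_gt0 ?ltr0n// ln1; lra.
Qed.

Lemma ln_sub_le (z t : R) : 0 < z -> 0 <= t -> ln (z + t) - ln z <= t / z.
Proof.
move=> z0 t0; rewrite -ln_div ?posrE ?ltr_wpDr// mulrDl divff ?gt_eqF//.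
by apply: le_ln1Dx; rewrite (lt_le_trans (ltrN10 _))// divr_ge0// ltW.
Qed.

Lemma lnstep_le (i : nat) : (0 < i)%N -> lnstep (theta * i%:R) <= i%:R^-1.
Proof.
move=> i0; rewrite (le_trans (ln_sub_le _ (ltW theta_gt0))) ?mulr_gt0 ?ltr0n//.
by rewrite invfM mulrA divff ?gt_eqF// mul1r.
Qed.


(** [Phi] is the mass of the points in the branches of index at least [i] that are sent below [t];
    [Psi] is the closed form of the corresponding telescoping series. *)
Let Phi (t : R) (i : nat) :=
  fine (P (`]0%R, (theta * i%:R)^-1]%classic `&` T @^-1` `]-oo, t[%classic)).
Let Psi (t : R) (i : nat) := C * (ln (theta * i%:R + t) - ln (theta * i%:R)).

Lemma measurable_lt_Ttheta (t : R) : measurable (T @^-1` `]-oo, t[%classic).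
Proof. exact: (@measurable_preimage_iter _ theta 1). Qed.

(** Branch [i] contributes [C] times [lnstep (theta i)] - [lnstep (theta i + t)], which is also the
    decrement of [Psi] from [i] to [i + 1]. *)
Let PhiS t i : (m <= i)%N -> 0 < t <= theta ->
  Phi t i - Psi t i = Phi t i.+1 - Psi t i.+1.
Proof.
move=> mi /andP[t0 tt]; have i0 := leq_trans m_gt0 mi.
have ti : 0 < theta * i%:R by rewrite mulr_gt0// ltr0n.
have mle : theta * m%:R <= theta * i%:R by rewrite ler_pM2l// ler_nat.
rewrite {1}/Phi (@Ttheta_slab _ _ theta_gt0 i _ t)//; last 2 first.
- by rewrite lexx andbT ltf_pV2 ?posrE ?(mulr_gt0, ltr0n)// ltr_pM2l// ltr_nat.
- by rewrite t0.
rewrite fine_probU//; last 2 first.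
- by apply: measurableI => //; exact: measurable_lt_Ttheta.
- by apply: Ttheta_slab_disj => //; rewrite t0.
rewrite gauss_probE//; last by rewrite lerDl ltW.
rewrite -/(Phi t i.+1) /Psi /lnstep -natr1 (mulrDr theta) (mulr1 theta).
rewrite [theta * i%:R + t + theta]addrAC; lra.
Qed.

Let Phi_le t i : (m <= i)%N -> 0 <= Phi t i <= C * i%:R^-1.
Proof.
move=> mi; have i0 := leq_trans m_gt0 mi; rewrite fine_ge0//=.
apply: (@le_trans _ _ (fine (P `]0, (theta * i%:R)^-1]%classic))).
  apply: le_fine_prob => //.
  by apply: measurableI => //; exact: measurable_lt_Ttheta.
rewrite gauss_prob0E ?ler_pM2l ?gauss_const_gt0// ?ler_nat//.
exact: lnstep_le.
Qed.

Let Psi_le t i : (m <= i)%N -> 0 < t <= theta -> 0 <= Psi t i <= C * i%:R^-1.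
Proof.
move=> mi /andP[t0 tt]; have i0 := leq_trans m_gt0 mi.
have ti : 0 < theta * i%:R by rewrite mulr_gt0// ltr0n.
rewrite mulr_ge0 ?(ltW gauss_const_gt0)//=; last first.
  by rewrite subr_ge0 ler_ln ?posrE ?addr_gt0// lerDl ltW.
rewrite ler_pM2l ?gauss_const_gt0// (le_trans (ln_sub_le _ (ltW t0)))//.
by rewrite invfM mulrA ler_piMl// ?invr_ge0// ler_pdivrMr// mul1r.
Qed.

(* [Phi - Psi] does not depend on [i] and tends to [0]. *)
Let PhiE t i : (m <= i)%N -> 0 < t <= theta -> Phi t i = Psi t i.
Proof.
move=> mi t0; apply/eqP; rewrite -subr_eq0 -normr_le0; apply/ler_addgt0Pl => e e0.
rewrite addr0.
have cst n : Phi t i - Psi t i = Phi t (i + n)%N - Psi t (i + n)%N.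
  elim: n => [|n ->]; first by rewrite addn0.
  by rewrite addnS PhiS// (leq_trans mi)// leq_addr.
(* Beyond this index both [Phi] and [Psi] lie in [0, e], by their bounds of order 1/i. *)
pose n := (Num.trunc (C / e)).+1.
have Cn : C / e < n%:R by rewrite truncnS_gt.
have min : (m <= i + n)%N by rewrite (leq_trans mi)// leq_addr.
have n0 : 0 < (i + n)%:R :> R by rewrite ltr0n addnS.
have Ce : C * (i + n)%:R^-1 <= e.
  rewrite ler_pdivrMr// mulrC -ler_pdivrMr// (le_trans (ltW Cn))// ler_nat.
  exact: leq_addl.
rewrite (cst n).
have := Phi_le t min; have := Psi_le min t0.
by move=> /andP[p0 p1] /andP[q0 q1]; rewrite ler_norml; apply/andP; split; lra.
Qed.

Let slab_le j s : (0 < j)%N -> 0 <= s < theta ->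
  (theta * j.+1%:R)^-1 < (theta * j%:R + s)^-1 <= (theta * j%:R)^-1.
Proof.
move=> j0 /andP[s0 st]; have tj : 0 < theta * j%:R by rewrite mulr_gt0// ltr0n.
have tj1 : 0 < theta * j.+1%:R by rewrite mulr_gt0.
rewrite ltf_pV2 ?posrE ?tj1 ?ltr_wpDr// lef_pV2 ?posrE ?ltr_wpDr//.
by rewrite lerDl s0 andbT -natr1 mulrDr mulr1 ltrD2l.
Qed.

(* The branches [i > j] telescope to the branch density with [j + 1]; for
   [t > s] the point [1 / (theta j + t)] of branch [j] lies in the interval too. *)
Let one_step_ray j s t : (m <= j)%N -> 0 <= s < theta -> 0 < t <= theta ->
  P (`]0%R, (theta * j%:R + s)^-1]%classic `&` T @^-1` `]-oo, t[%classic) =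
  branch_measure theta j s `[0%R, t[%classic.
Proof.
move=> mj /andP[s0 st] /andP[t0 tt]; have j0 := leq_trans m_gt0 mj.
have tj : 0 < theta * j%:R by rewrite mulr_gt0// ltr0n.
have tj1 : 0 < theta * j.+1%:R by rewrite mulr_gt0.
have mle : theta * m%:R <= theta * j%:R by rewrite ler_pM2l// ler_nat.
have mT := measurable_lt_Ttheta t.
rewrite -[LHS]fineK ?fin_num_measure//; last exact: measurableI.
rewrite (@Ttheta_slab _ _ theta_gt0 j _ t)//; last 2 first.
- by apply: slab_le => //; rewrite s0.
- by rewrite t0.
rewrite fine_probU//; last 2 first.
- exact: measurableI.
- by apply: Ttheta_slab_disj => //; rewrite t0.
rewrite -/(Phi t j.+1) PhiE ?t0// ?(leq_trans mj)//.
(* For t <= s branch [j] contributes nothing, as its point 1/(theta j + t) is not below the right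
   end of the segment. Otherwise [0, t[ is cut at the jump [s] of the density. *)
have [ts|st'] := leP t s.
  rewrite set_itv_ge ?measure0 ?add0r; last first.
    by rewrite bnd_simp -leNgt lef_pV2 ?posrE ?ltr_wpDr// ?lerD2l// ltW.
  rewrite (@branch_measure_itv _ _ _ _ (theta * j.+1%:R))//; last 3 first.
  - by rewrite addr0.
  - exact: ltW.
  - by move=> x /andP[_ xt]; rewrite (lt_le_trans xt ts) addn1.
  by rewrite addr0.
rewrite gauss_probE//; last 2 first.
- by rewrite (le_trans mle)// lerDl.
- by rewrite lerD2l ltW.
have -> : `[0, t[%classic = `[0, s[%classic `|` `[s, t[%classic.
  by rewrite -itv_bndbnd_setU// bnd_simp// ltW.
rewrite measureU//=; last first.
  apply/seteqP; split => // x [/=]; rewrite !in_itv/= => /andP[_ xs] /andP[sx _].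
  by move: (lt_le_trans xs sx); rewrite ltxx.
rewrite (@branch_measure_itv _ _ _ _ (theta * j.+1%:R))//; last 3 first.
- by rewrite addr0.
- exact: ltW.
- by move=> x /andP[_ xt]; rewrite xt addn1.
rewrite (@branch_measure_itv _ _ _ _ (theta * j%:R))//; last 3 first.
- by rewrite ltr_wpDr.
- exact: ltW.
- by move=> x /andP[sx _]; rewrite ltNge sx addn0.
rewrite -EFinD; congr (_%:E).
rewrite /Psi /lnstep -natr1 (mulrDr theta) (mulr1 theta) addr0.
rewrite [_ + t + theta]addrAC [_ + s + theta]addrAC; lra.
Qed.

(** Both sides are measures in [E] that agree on the rays ]-oo, t[, a generating family closed under
    intersection. Rays with t <= 0 have mass zero on both sides, and those with t > theta reduce to
    t = theta because T < theta. *)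
Lemma one_step j s (E : set R) : (m <= j)%N -> 0 <= s < theta -> measurable E ->
  P (`]0%R, (theta * j%:R + s)^-1]%classic `&` T @^-1` E) =
  branch_measure theta j s E.
Proof.
move=> mj /andP[s0 st] mE; have j0 := leq_trans m_gt0 mj.
have tj : 0 < theta * j%:R by rewrite mulr_gt0// ltr0n.
have mle : theta * m%:R <= theta * j%:R by rewrite ler_pM2l// ler_nat.
set D := `]0%R, _]%classic; have mD : measurable D by exact: measurable_itv.
have DE x : D x -> 0 <= x <= theta.
  rewrite /D /= in_itv/= => /andP[x0 xs]; rewrite (ltW x0) (le_trans xs)//.
  rewrite -[leRHS]invrK lef_pV2 ?posrE ?invr_gt0 ?ltr_wpDr//.
  by rewrite theta_inv// (le_trans mle)// lerDl.
have mT : measurable_fun setT (T : measurableTypeR R -> measurableTypeR R).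
  exact: measurable_Ttheta.
rewrite setIC -[LHS]/(pushforward (mrestr P mD) T E).
pose m1 := pushforward (mrestr P mD) (T : measurableTypeR R -> measurableTypeR R)
  : {measure set (measurableTypeR R) -> \bar R}.
rewrite -[LHS]/(m1 mT E).
apply: (@measure_unique _ _ (measurableTypeR R) (@RGenInftyO.G R)
  (fun n => `]-oo, n%:R[%classic)) => //.
- exact: RGenInftyO.measurableE.
- move=> _ _ [x ->] [y ->]; exists (Num.min x y).
  by apply/seteqP; split => z /=; rewrite !in_itv/= lt_min => /andP.
- by move=> n; exists n%:R.
- apply/seteqP; split => // x _; exists (Num.trunc x).+1 => //=.
  by rewrite in_itv/= truncnS_gt.
- move=> _ [t ->]; rewrite /m1 /= /pushforward /mrestr setIC.
  have [t0|t0] := leP t 0.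
    rewrite -branch_measureI.
    rewrite [X in P X](_ : _ = set0); last first.
      apply/seteqP; split => // x [/DE/andP[/(Ttheta_itv theta_gt0)/andP[+ _]]] _ /=.
      by rewrite in_itv/= => T0 Tt; move: (lt_le_trans Tt (le_trans t0 T0)); rewrite ltxx.
    rewrite [X in branch_measure _ _ _ X](_ : _ = set0) ?measure0//.
    apply/seteqP; split => // x [] /=; rewrite !in_itv/= => xt /andP[x0 _].
    by move: (lt_le_trans xt (le_trans t0 x0)); rewrite ltxx.
  have [tt|tt] := leP t theta.
    rewrite one_step_ray ?t0 ?s0//.
    rewrite -[RHS]branch_measureI -[LHS]branch_measureI; congr (branch_measure _ _ _ _).
    apply/seteqP; split => x /=; rewrite !in_itv/=.
      by move=> [/andP[_ ->] ->].
    by move=> [-> /andP[-> ->]].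
  rewrite (_ : D `&` _ = D `&` T @^-1` `]-oo, theta[%classic); last first.
    apply/seteqP; split => x [Dx]; rewrite /= !in_itv/= => Tx; split => //=.
      by have /andP[/(Ttheta_itv theta_gt0)/andP[_ ->]] := DE _ Dx.
    exact: lt_trans tt.
  rewrite one_step_ray ?theta_gt0 ?s0 ?lexx//; rewrite -branch_measure_cc -[RHS]branch_measureI.
  congr (branch_measure _ _ _ _).
  apply/seteqP; split => x /=; rewrite !in_itv/=.
    by move=> /andP[-> xt]; rewrite (le_lt_trans xt).
  by move=> [_ ->].
- move=> n; rewrite /m1/= /pushforward /mrestr -ge0_fin_numE// fin_num_measure//.
  by apply: measurableI => //; exact: measurable_lt_Ttheta.
Qed.
End gauss_prob.

(** * Exponential mixing on initial segments *)

Section layer_cake.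
Context d (T : measurableType d) (R : realType) (P : probability T R).
Variables (q : set T -> R) (w : T -> R) (w0 eta : R).
Hypotheses (eta_gt0 : 0 < eta) (w0_ge0 : 0 <= w0).
Hypothesis w_bnd : forall x, w0 <= w x < w0 + eta.
Hypothesis mw : forall r, measurable [set x | w x < r].
Hypothesis qU : forall A B, measurable A -> measurable B -> A `&` B = set0 ->
  q (A `|` B) = q A + q B.
(** Together with additivity, [q_ge] and [q_le] express that [q] has density [w] with respect to
    [P], without mentioning an integral. *)
Hypothesis q_ge : forall X r, measurable X -> 0 <= r ->
  (forall x, X x -> r <= w x) -> r * fine (P X) <= q X.
Hypothesis q_le : forall X r, measurable X -> 0 <= r ->
  (forall x, X x -> w x <= r) -> q X <= r * fine (P X).

Let lev (X : set T) r := X `&` [set x | w x < r].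

Let F (X : set T) (e : R) (i : nat) := fine (P (lev X (w0 + i%:R * e))).

(** Lower and upper Riemann sums of [w] over its slices of height [e], after summation by parts. *)
Let slices (X : set T) (e : R) (n : nat) : measurable X -> 0 <= e ->
  (w0 + n%:R * e) * F X e n - e * (\sum_(i < n) F X e i.+1) <= q (lev X (w0 + n%:R * e))
    <= (w0 + n%:R * e) * F X e n - e * (\sum_(i < n) F X e i).
Proof.
move=> mX e0.
have mlev r : measurable (lev X r) by exact: measurableI.
elim: n => [|n IHn].
  (* No point has w < w0, so the boundary term of the summation by parts vanishes. *)
  have l0 : lev X w0 = set0.
    apply/seteqP; split => // x [_ /=]; have /andP[+ _] := w_bnd x.
    by move=> /le_lt_trans h /h; rewrite ltxx.
  rewrite !big_ord0 /F mul0r addr0 l0 measure0/= !mulr0 subrr.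
  have := @q_ge set0 0 measurable0 (lexx _) (fun x => False_ind _).
  have := @q_le set0 0 measurable0 (lexx _) (fun x => False_ind _).
  by rewrite !mul0r => -> ->.
set r := w0 + n%:R * e in IHn *; set r' := w0 + n.+1%:R * e.
have rr' : r' = r + e by rewrite /r' /r -natr1 mulrDl mul1r addrA.
have r0 : 0 <= r by rewrite addr_ge0// mulr_ge0.
pose S := lev X r' `&` ~` lev X r.
have mS : measurable S by apply: measurableI => //; exact: measurableC.
have levE : lev X r' = lev X r `|` S.
  apply/seteqP; split => x.
    by move=> h; have [?|?] := pselect (lev X r x); [left|right].
  move=> [[Xx /= wr]|[]//]; split => //=.
  by rewrite (lt_le_trans wr)// rr' lerDl.
have disj : lev X r `&` S = set0 by rewrite /S setICA setICr setI0.
have FS : F X e n.+1 = F X e n + fine (P S) by rewrite {1}/F -/r' levE fine_probU.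
have lo : r * fine (P S) <= q S.
  apply: q_ge => // x [[Xx _] nl]; rewrite leNgt; apply/negP => wr.
  by apply: nl; split.
have hi : q S <= r' * fine (P S).
  by apply: q_le => //; [rewrite rr' addr_ge0|move=> x [[_ /ltW]]].
rewrite levE qU// !big_ord_recr/=.
move: IHn lo hi; rewrite -/(F X e n) FS rr'.
set a := q _; set b := q _; set pS := fine _; set f := F X e n.
set s1 := \sum_(i < n) F X e i.+1; set s2 := \sum_(i < n) _.
move=> /andP[h1 h2] lo hi; apply/andP; split; nra.
Qed.

(** Compare the slice sums of [E] with those of the whole space multiplied by P(E). The leading
    terms (w0 + eta) P(E) cancel; what remains is eta/N times a sum of [N] differences, each at most
    c P(E) by hypothesis. *)
Lemma layer_cake (E : set T) (c : R) : measurable E -> 0 <= c ->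
  (forall r, `|fine (P ([set x | w x < r] `&` E)) -
      fine (P [set x | w x < r]) * fine (P E)| <= c * fine (P E)) ->
  `|q E - q setT * fine (P E)| <= eta * c * fine (P E).
Proof.
move=> mE c0 hc; apply/ler_addgt0Pl => e e0.
pose N := (Num.trunc (eta / e)).+1.
have N0 : 0 < N%:R :> R by rewrite ltr0n.
have eN : eta / N%:R <= e.
  by rewrite ler_pdivrMr// mulrC -ler_pdivrMr// ltW// truncnS_gt.
pose dl := eta / N%:R; have dl0 : 0 <= dl by rewrite divr_ge0// ltW.
have topE X : lev X (w0 + N%:R * dl) = X.
  apply/seteqP; split => [x []//|x Xx]; split => //=.
  rewrite /dl mulrCA divff ?gt_eqF// mulr1.
  by have /andP[] := w_bnd x.
have /andP[E1 E2] := @slices E dl N mE dl0.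
have /andP[T1 T2] := @slices setT dl N measurableT dl0.
have FN X : F X dl N = fine (P X) by rewrite /F topE.
move: E1 E2 T1 T2; rewrite !topE !FN probability_setT/= mulr1.
set pE := fine (P E).
have pE0 : 0 <= pE by exact: fine_prob_ge0.
have pE1 : pE <= 1 by exact: fine_prob_le1.
pose F' := F E dl; pose G := F setT dl.
have FG i : `|F' i - G i * pE| <= c * pE.
  by rewrite /F' /G /F /lev setTI setIC; exact: hc.
have G01 i : 0 <= G i <= 1.
  by rewrite fine_prob_ge0 fine_prob_le1//; exact: measurableI.
(* The two slice sums differ by one telescoped term; after multiplication by the mesh it costs at
   most [e]. *)
have sumG : \sum_(i < N) G i.+1 = \sum_(i < N) G i + (G N - G 0%N).
  by rewrite [in LHS]big_ord_recr big_ord_recl/=; lra.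
have sumc : N%:R * (c * pE) = \sum_(i < N) c * pE.
  by rewrite sumr_const card_ord mulr_natl.
have h1 : (\sum_(i < N) G i) * pE <= \sum_(i < N) F' i + N%:R * (c * pE).
  rewrite sumc mulr_suml -big_split/=; apply: ler_sum => i _.
  by have := FG i; rewrite ler_norml; lra.
have h2 : \sum_(i < N) F' i.+1 <= (\sum_(i < N) G i.+1) * pE + N%:R * (c * pE).
  rewrite sumc mulr_suml -big_split/=; apply: ler_sum => i _.
  by have := FG i.+1; rewrite ler_norml; lra.
have Nd : N%:R * dl = eta by rewrite /dl mulrCA divff ?gt_eqF// mulr1.
move: (G01 N) (G01 0%N) sumG h1 h2 => /andP[GN0 GN1] /andP[G00 G01'].
set sG := \sum_(i < N) G i; set sG' := \sum_(i < N) G i.+1.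
set sF := \sum_(i < N) F' i; set sF' := \sum_(i < N) F' i.+1.
move=> sumG h1 h2 E1 E2 T1 T2.
have k1 : dl * (sG * pE) <= dl * sF + eta * c * pE.
  by rewrite -Nd; have := ler_wpM2l dl0 h1; lra.
have k2 : dl * sF' <= dl * (sG' * pE) + eta * c * pE.
  by rewrite -Nd; have := ler_wpM2l dl0 h2; lra.
have k3 : dl * (sG' * pE) <= dl * (sG * pE) + e.
  rewrite sumG mulrDl mulrDr lerD2l (le_trans _ eN)// -[leRHS]mulr1 ler_wpM2l//.
  by rewrite (le_trans _ pE1)// ler_piMl//; lra.
have T1' := ler_wpM2r pE0 T1; have T2' := ler_wpM2r pE0 T2.
by rewrite ler_norml; apply/andP; split; lra.
Qed.

End layer_cake.

Lemma norm_subM_le (R : realType) (u v t : R) :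
  0 <= u <= t -> 0 <= v <= 1 -> `|u - v * t| <= t.
Proof.
move=> /andP[u0 ut] /andP[v0 v1]; have t0 := le_trans u0 ut.
have p0 : 0 <= v * t by rewrite mulr_ge0.
have p1 : v * t <= t by rewrite ler_piMl.
by rewrite ler_norml; apply/andP; split; lra.
Qed.

(** * Contraction of correlations on initial segments *)

Section mixing.
Variables (R : realType) (theta : R) (m : nat).
Hypotheses (theta_gt0 : 0 < theta) (theta_sq : theta ^+ 2 = m%:R^-1).
Hypothesis m_gt1 : (1 < m)%N.
Local Notation T := (Ttheta theta).
Local Notation P := (gauss_prob theta_gt0 theta_sq).

Lemma eq_gauss_prob_itv (A B : set R) : A `&` `[0, theta]%classic = B `&` `[0, theta]%classic ->
  P A = P B.
Proof.
move=> AB; rewrite /gauss_prob /gauss_measure -[LHS]branch_measureI.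
by rewrite -[RHS]branch_measureI AB.
Qed.

(** Take for [j] the first digit of [a] and for [s] its image [T a], since 1/a = theta j + T a.
    Every nonempty initial segment thus has the form required by [one_step]. *)
Lemma itv_Ttheta_decomp (a : R) : 0 < a <= theta ->
  exists j s, [/\ (m <= j)%N, 0 <= s < theta & a = (theta * j%:R + s)^-1].
Proof.
move=> /andP[a0 at_]; exists `|Num.floor (theta * a)^-1|%N, (T a).
have ta : 0 < (theta * a)^-1 by rewrite invr_gt0 mulr_gt0.
have fl0 : 0 <= Num.floor (theta * a)^-1 by rewrite floor_ge0 ltW.
have flE : (`|Num.floor (theta * a)^-1|%N)%:R = (Num.floor (theta * a)^-1)%:~R :> R.
  by rewrite -[in RHS](gez0_abs fl0).
split; last 2 first.
- exact/(Ttheta_itv theta_gt0)/ltW.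
- by rewrite flE /Ttheta gt_eqF// addrC subrK invrK.
rewrite -lez_nat gez0_abs// floor_ge_int -pmulrn -[leLHS]invrK -theta_sq.
by rewrite lef_pV2 ?posrE ?mulr_gt0// expr2 ler_pM2l.
Qed.

Let m_gt0 : (0 < m)%N := ltnW m_gt1.

(* Outside [0, theta] both densities vanish; the value of [w] there only has to
   stay in the range of [w]. *)
Let w j s (x : R) : R := if 0 <= x <= theta
  then (theta * m%:R + x) / (theta * (j + (x < s)%R)%:R + x)
  else m%:R / j.+1%:R.

Let den_gt0 j (b : bool) x : (m <= j)%N -> 0 <= x ->
  0 < theta * (j + b)%:R + x.
Proof.
move=> mj x0; rewrite ltr_wpDr// mulr_gt0// ltr0n.
by rewrite (leq_trans m_gt0)// (leq_trans mj)// leq_addr.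
Qed.

(** On [0, theta] the values lie between m/(j + 1) and (m + 1)/(j + 1); the gap 1/(j + 1) is below
    1/2 because j >= m >= 2. *)
Let w_bnd j s x : (m <= j)%N ->
  m%:R / j.+1%:R <= w j s x < m%:R / j.+1%:R + 1 / 2.
Proof.
move=> mj; rewrite /w; case: ifPn => [/andP[x0 xt]|_]; last first.
  by rewrite lexx ltrDl divr_gt0.
have d0 := den_gt0 (x < s) mj x0.
have mj' : m%:R <= j%:R :> R by rewrite ler_nat.
have m2 : 2 <= m%:R :> R by rewrite (ler_nat _ 2).
set b : R := (j + _)%:R in d0 *.
have [bj bj1] : j%:R <= b /\ b <= j%:R + 1.
  by rewrite /b natrD; case: (x < s) => /=; split; lra.
apply/andP; split.
  rewrite ler_pdivrMr// mulrAC ler_pdivlMr// -natr1.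
  have p1 : 0 <= theta * m%:R * (j%:R + 1 - b).
    by rewrite !mulr_ge0 ?(ltW theta_gt0)//; lra.
  have p2 : 0 <= x * (j%:R + 1 - m%:R) by rewrite mulr_ge0//; lra.
  lra.
have j1 : j.+1%:R = j%:R + 1 :> R by rewrite natr1.
apply: (@le_lt_trans _ _ ((m%:R + 1) / j.+1%:R)).
  rewrite ler_pdivrMr// mulrAC ler_pdivlMr// j1.
  have p1 : 0 <= theta * (m%:R + 1) * (b - j%:R).
    by rewrite !mulr_ge0 ?(ltW theta_gt0)//; lra.
  have p2 : 0 <= (theta - x) * (j%:R - m%:R) by rewrite mulr_ge0//; lra.
  lra.
rewrite mulrDl ltrD2l ltr_pdivrMr// j1; lra.
Qed.

(** Crossing [s] lowers the denominator, and on either side the quotient increases as j >= m. After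
    clearing denominators the difference is exactly [p1 + p2 + p3]. *)
Let w_nd j s x y : (m <= j)%N -> 0 <= x -> x <= y -> y <= theta ->
  w j s x <= w j s y.
Proof.
move=> mj x0 xy yt; have y0 := le_trans x0 xy; have xt := le_trans xy yt.
rewrite /w x0 xt y0 yt/= ler_pdivrMr ?den_gt0// mulrAC ler_pdivlMr ?den_gt0//.
have mj' : m%:R <= j%:R :> R by rewrite ler_nat.
set b := (j + (y < s)%R)%:R; set b' := (j + (x < s)%R)%:R.
have bb' : b <= b'.
  rewrite ler_nat leq_add2l; have [ys|//] := ltP y s.
  by rewrite (le_lt_trans xy ys).
have jb : j%:R <= b by rewrite ler_nat leq_addr.
have p1 : 0 <= theta ^+ 2 * m%:R * (b' - b).
  by rewrite !mulr_ge0 ?sqr_ge0//; lra.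
have p2 : 0 <= theta * y * (b' - b) by rewrite !mulr_ge0 ?(ltW theta_gt0)//; lra.
have p3 : 0 <= theta * (b - m%:R) * (y - x).
  by rewrite !mulr_ge0 ?(ltW theta_gt0)//; lra.
lra.
Qed.

Let measurable_w j s : measurable_fun setT (w j s).
Proof.
apply: measurable_fun_ifT => //.
  by apply: measurable_and; exact: measurable_fun_ler.
apply: measurable_funM; first exact: measurable_funD.
apply: (measurableT_comp (@measurable_invr R)).
by apply: measurable_funD => //; apply: measurable_funM => //; exact: measurable_step.
Qed.

(** So [w] is the density of the branch measure relative to the invariant one, which yields the two
    comparison bounds needed for [layer_cake]. *)
Let branch_density_w j s x :
  branch_density theta j s x = w j s x * branch_density theta m 0 x.
Proof.
rewrite /branch_density /w; case: ifPn => [/andP[x0 xt]|_]; last by rewrite mulr0.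
rewrite (ltNge x 0) x0 addn0 mulrCA mulrAC mulrA; congr (_ * _).
rewrite divff ?mulr1// gt_eqF//.
by have := den_gt0 false (leqnn m) x0; rewrite addn0.
Qed.

Let branch_measure_w (X : set R) (r : R) : measurable X -> 0 <= r ->
  (r%:E * P X = \int[@lebesgue_measure R]_(x in X) (r * branch_density theta m 0 x)%:E)%E.
Proof.
move=> mX r0; under eq_integral do rewrite EFinM.
rewrite ge0_integralZl_EFin//.
- by move=> x _; rewrite lee_fin branch_density_ge0.
- by apply/measurable_EFinP/measurable_funTS; exact: measurable_branch_density.
Qed.

Let branch_measure_ge j s (X : set R) (r : R) : measurable X -> 0 <= r ->
  (forall x, X x -> r <= w j s x) -> (r%:E * P X <= branch_measure theta j s X)%E.
Proof.
move=> mX r0 rw; rewrite branch_measure_w//; apply: ge0_le_integral => //.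
- by move=> x _; rewrite lee_fin mulr_ge0 ?branch_density_ge0.
- apply/measurable_EFinP; apply: measurable_funM => //; apply/measurable_funTS.
  exact: measurable_branch_density.
- by apply/measurable_EFinP/measurable_funTS; exact: measurable_branch_density.
- move=> x Xx; rewrite lee_fin (branch_density_w j s) ler_wpM2r ?branch_density_ge0//.
  exact: rw.
Qed.

Let branch_measure_le j s (X : set R) (r : R) : measurable X -> 0 <= r ->
  (forall x, X x -> w j s x <= r) -> (branch_measure theta j s X <= r%:E * P X)%E.
Proof.
move=> mX r0 rw; rewrite branch_measure_w//; apply: ge0_le_integral => //.
- by move=> x _; rewrite lee_fin branch_density_ge0.
- by apply/measurable_EFinP/measurable_funTS; exact: measurable_branch_density.
- apply/measurable_EFinP; apply: measurable_funM => //; apply/measurable_funTS.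
  exact: measurable_branch_density.
- move=> x Xx; rewrite lee_fin (branch_density_w j s) ler_wpM2r ?branch_density_ge0//.
  exact: rw.
Qed.

(** A set closed downwards agrees with ]0, sup W] except possibly at the points 0 and sup W, which
    are null. The empty set corresponds to b = 0. *)
Let segment (W : set R) : measurable W -> W `<=` `[0, theta]%classic ->
  (forall x y, 0 <= x -> x <= y -> W y -> W x) ->
  exists2 b, 0 <= b <= theta & forall E, measurable E ->
    fine (P (W `&` E)) = fine (P (`]0, b]%classic `&` E)).
Proof.
move=> mW Wt Wd; have [->|/set0P[y0 Wy0]] := eqVneq W set0.
  exists 0; first by rewrite lexx ltW.
  by move=> E mE; rewrite set_itvoc0 !set0I.
have hs : has_sup W.
  split; first by exists y0.
  by exists theta => x /Wt; rewrite /= in_itv/= => /andP[].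
have Wsup x : W x -> x <= sup W by apply: sup_upper_bound.
exists (sup W).
  rewrite (le_trans _ (Wsup _ Wy0))/=; last first.
    by have := Wt _ Wy0; rewrite /= in_itv/= => /andP[].
  by apply: sup_le_ub => [|x /Wt]; [exists y0|rewrite /= in_itv/= => /andP[]].
move=> E mE; pose N := [set 0; sup W].
have mN : measurable N by apply: measurableU; exact: measurable_set1.
have N0 : P N = 0%E.
  by rewrite /N null_set_setU//=; exact: branch_measure1.
rewrite -(@fine_probI_null _ _ _ P (W `&` E) N)//; last exact: measurableI.
rewrite -[RHS](@fine_probI_null _ _ _ P _ N)//; last exact: measurableI.
congr (fine (P _)); apply/seteqP; split => x [[Wx Ex] Nx]; split => //; split => //.
  rewrite /= in_itv/= Wsup// andbT lt_def.
  have := Wt _ Wx; rewrite /= in_itv/= => /andP[-> _]; rewrite andbT.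
  by apply/eqP => x0; apply: Nx; left.
move: Wx; rewrite /= in_itv/= => /andP[x0 xs].
have {}xs : x < sup W.
  by rewrite lt_def xs andbT; apply/eqP => sx; apply: Nx; right.
have [y Wy xy] := sup_gt (proj1 hs) xs.
exact: Wd (ltW x0) (ltW xy) Wy.
Qed.

Lemma gauss_prob_oc (X : set R) : measurable X ->
  fine (P (`]0, theta]%classic `&` X)) = fine (P X).
Proof.
move=> mX; have m0 : measurable [set 0 : R] by exact: measurable_set1.
rewrite -[RHS](@fine_probI_null _ _ _ P _ [set 0])//; last exact: branch_measure1.
congr fine; apply: eq_gauss_prob_itv; apply/seteqP; split => x /=; rewrite !in_itv/=.
  move=> [[/andP[x0 xt] Xx] _]; split; last by rewrite ltW.
  by split => //; apply/eqP; rewrite gt_eqF.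
move=> [[Xx /eqP xn0] /andP[x0 xt]]; split; last by rewrite x0.
by rewrite lt_def xn0 x0.
Qed.

(** The case j = m, s = 0 of [one_step]: the segment is then all of ]0, theta] and the branch
    measure is the invariant one. *)
Lemma gauss_prob_Ttheta (B : set R) : measurable B ->
  fine (P (T @^-1` B)) = fine (P B).
Proof.
move=> mB; rewrite -gauss_prob_oc; last exact: (@measurable_preimage_iter _ theta 1).
have s0 : 0 <= (0 : R) < theta by rewrite lexx.
have := one_step theta_gt0 theta_sq (leqnn m) s0 mB.
by rewrite addr0 -(theta_inv theta_gt0 theta_sq) invrK => ->.
Qed.

Lemma gauss_prob_iter (B : set R) k : measurable B ->
  fine (P (iter k T @^-1` B)) = fine (P B).
Proof.
move=> mB; elim: k => [//|k <-].
rewrite -[RHS]gauss_prob_Ttheta; last exact: measurable_preimage_iter.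
by congr (fine (P _)); apply/funext => x; rewrite /preimage /= -iterS iterSr.
Qed.

(** The induction on [k] is over all endpoints [a] at once: the step from [k] to [k + 1] uses the
    hypothesis at the endpoints of the level sets of [w], and the oscillation of [w] supplies the
    new factor 1/2. *)
Lemma mixing k (a : R) (B : set R) : measurable B -> 0 <= a <= theta ->
  `|fine (P (`]0, a]%classic `&` iter k T @^-1` B)) -
    fine (P `]0, a]%classic) * fine (P B)| <= 2^-1 ^+ k * fine (P B).
Proof.
move=> mB; elim: k a => [|k IHk] a.
  move=> _; rewrite expr0 mul1r.
  have mI : measurable (`]0, a]%classic `&` B) by exact: measurableI.
  have h1 : fine (P (`]0, a]%classic `&` B)) <= fine (P B) by exact: le_fine_prob.
  have h2 := fine_prob_le1 P (measurable_itv `]0, a]).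
  have h3 := fine_prob_ge0 P B; have h4 := fine_prob_ge0 P `]0, a]%classic.
  have h5 := fine_prob_ge0 P (`]0, a]%classic `&` B).
  by apply: norm_subM_le; rewrite ?h5 ?h4.
move=> /andP[]; rewrite le_eqVlt => /predU1P[<- _|a0 at_].
  rewrite set_itvoc0 set0I measure0 mul0r subrr normr0.
  by rewrite mulr_ge0 ?exprn_ge0 ?invr_ge0// fine_prob_ge0.
have [|j [s [mj s0t ->]]] := @itv_Ttheta_decomp a; first by rewrite a0.
pose E := iter k T @^-1` B.
have mE : measurable E by exact: measurable_preimage_iter.
have -> : iter k.+1 T @^-1` B = T @^-1` E.
  by apply/funext => x; rewrite /preimage /E /= -iterS iterSr.
set D := `]0, _]%classic; have mD : measurable D by exact: measurable_itv.
have DE : fine (P D) = fine (branch_measure theta j s setT).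
  by rewrite -(one_step theta_gt0 theta_sq mj s0t measurableT) preimage_setT setIT.
have QF X : measurable X -> branch_measure theta j s X \is a fin_num.
  move=> mX; rewrite -(one_step theta_gt0 theta_sq mj s0t mX) fin_num_measure//.
  apply: measurableI; first exact: measurable_itv.
  exact: (@measurable_preimage_iter _ theta 1).
rewrite /D one_step// -/D DE -(gauss_prob_iter k mB) -/E exprS.
have := @layer_cake _ _ _ P (fine \o branch_measure theta j s) (w j s)
  (m%:R / j.+1%:R) (1 / 2) _ _ _ _ _ _ _ E (2^-1 ^+ k).
rewrite (div1r 2) /=; apply => //.
- by move=> x; rewrite -(div1r 2); exact: w_bnd.
- move=> r; rewrite -[X in measurable X]setTI.
  have -> : [set x | w j s x < r] = w j s @^-1` `]-oo, r[%classic.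
    by apply/seteqP; split => x /=; rewrite in_itv.
  exact: measurable_w.
- by move=> A A' mA mA' AA'; rewrite measureU// fineD ?QF.
- move=> X r mX r0 rw; rewrite -lee_fin EFinM !fineK ?QF ?fin_num_measure//.
  exact: branch_measure_ge.
- move=> X r mX r0 rw; rewrite -lee_fin EFinM !fineK ?QF ?fin_num_measure//.
  exact: branch_measure_le.
move=> r; set W0 := [set x | _].
have mW0 : measurable W0.
  rewrite -[X in measurable X]setTI.
  have -> : W0 = w j s @^-1` `]-oo, r[%classic.
    by apply/seteqP; split => x /=; rewrite in_itv.
  exact: measurable_w.
(* Within [0, theta] the level set is closed downwards by [w_nd]; the part outside is null. *)
pose W := W0 `&` `[0, theta]%classic.
have mW : measurable W by exact: measurableI.
have [|x y x0 xy [Wy yt]|b bt Wb] := segment mW.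
- exact: subIsetr.
- move: yt; rewrite /= in_itv/= => /andP[y0 yt]; split; last first.
    by rewrite /= in_itv/= x0 (le_trans xy).
  by rewrite /W0 /=; apply: le_lt_trans Wy; exact: w_nd.
have WE X : measurable X -> fine (P (W0 `&` X)) = fine (P (`]0, b]%classic `&` X)).
  move=> mX; rewrite -Wb//; congr fine; apply: eq_gauss_prob_itv.
  by apply/seteqP; split => x [[wx Xx] tx]; do ?split => //; case: wx.
rewrite WE// -[W0]setIT WE// setIT gauss_prob_iter//.
exact: IHk.
Qed.

End mixing.

(** * Truncated digit sums and the weak law *)

Lemma sum_ltn_min (R : pzSemiRingType) (M l : nat) :
  \sum_(j < M) (j < l)%N%:R = (minn M l)%:R :> R.
Proof.
elim: M => [|M IHM]; first by rewrite big_ord0 min0n.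
rewrite big_ord_recr/= IHM -natrD; congr _%:R.
by have [Ml|lM] := ltnP M l; lia.
Qed.

(** The exponent is |k - l| in truncated subtraction. The terms with l < k add up to at most 1,
    those with l >= k to at most 2. *)
Lemma sum_half_dist_le (R : realFieldType) (k n : nat) :
  \sum_(l < n) (2^-1 : R) ^+ ((k - l) + (l - k)) <= 3.
Proof.
pose g n := \sum_(l < n) (2^-1 : R) ^+ ((k - l) + (l - k)).
have h0 (i : nat) : 0 <= (2^-1 : R) ^+ i by rewrite exprn_ge0// invr_ge0.
have lo i : (i <= k)%N -> g i <= 2^-1 ^+ (k - i).
  elim: i => [_|i IHi ik]; first by rewrite /g big_ord0.
  rewrite /g big_ord_recr/= -/(g i).
  rewrite (eqP (ltnW ik : i - k == 0)%N) addn0.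
  have := IHi (ltnW ik).
  have -> : (k - i)%N = (k - i.+1).+1 by lia.
  by rewrite exprS; lra.
have hi i : g (k + i)%N <= 3 - 2 * 2^-1 ^+ i.
  elim: i => [|i IHi].
    by rewrite addn0 (le_trans (lo _ (leqnn _)))// subnn !expr0; lra.
  rewrite addnS /g big_ord_recr/= -/(g (k + i)%N).
  have -> : (k - (k + i) + (k + i - k))%N = i by lia.
  by rewrite exprS; lra.
have [nk|kn] := leqP n k.
  rewrite (le_trans (lo _ nk))// (le_trans _ (_ : 1 <= 3))//.
    by rewrite exprn_ile1// ?invr_ge0// invf_le1// ler1n.
  by rewrite ler1n.
rewrite -/(g n) -(subnKC (ltnW kn)) (le_trans (hi _))//.
by have := h0 (n - k)%N; lra.
Qed.

Section digit_sums.
Variables (R : realType) (theta : R) (m : nat).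
Hypotheses (theta_gt0 : 0 < theta) (theta_sq : theta ^+ 2 = m%:R^-1).
Hypothesis m_gt1 : (1 < m)%N.
Local Notation T := (Ttheta theta).
Local Notation C := (gauss_const theta).
Local Notation P := (gauss_prob theta_gt0 theta_sq).

(** Within [0, theta], the event that the first digit exceeds [j], written as an initial segment so
    that [mixing] applies. For j + 1 <= m it is all of ]0, theta]. *)
Definition digit_gt (j : nat) : set R :=
  `]0, Num.min theta (theta * j.+1%:R)^-1]%classic.

Let tj_gt0 j : 0 < theta * j.+1%:R. Proof. by rewrite mulr_gt0. Qed.

Let minj j : 0 <= Num.min theta (theta * j.+1%:R)^-1 <= theta.
Proof. by rewrite le_min ge_min lexx invr_ge0 (ltW theta_gt0) (ltW (tj_gt0 j)). Qed.

Lemma measurable_digit_gt j : measurable (digit_gt j).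
Proof. exact: measurable_itv. Qed.

Lemma measurable_iter_digit_gt k j : measurable (iter k T @^-1` digit_gt j).
Proof. by apply: measurable_preimage_iter; exact: measurable_digit_gt. Qed.

Let dg (y : R) : int := Num.floor ((theta * y)^-1).

Let dg_ge0 y : 0 <= y -> 0 <= dg y.
Proof. by move=> y0; rewrite floor_ge0 invr_ge0 mulr_ge0// ltW. Qed.

Lemma digit_gtE j (y : R) : 0 <= y <= theta ->
  digit_gt j y <-> (j < `|Num.floor ((theta * y)^-1)|)%N.
Proof.
move=> /andP[y0 yt]; rewrite -ltz_nat (gez0_abs (dg_ge0 y0)) /digit_gt /=.
rewrite in_itv/= le_min yt/= -(lezD1 j%:Z) -PoszD addn1 floor_ge_int -pmulrn.
(* At y = 0 the digit is 0 because 0^-1 = 0, matching the exclusion of 0 from the segment. *)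
move: y0; rewrite le_eqVlt => /predU1P[<-|y0].
  by rewrite ltxx/= mulr0 invr0; split => //; rewrite lern0.
rewrite y0/= -[X in _ <-> is_true (X <= _)]invrK lef_pV2 ?posrE ?invr_gt0 ?mulr_gt0//.
rewrite invfM; split => h.
  by rewrite -(ler_pM2l theta_gt0) mulrA divff ?gt_eqF// mul1r in h *.
by rewrite -(ler_pM2l theta_gt0) mulrA divff ?gt_eqF// mul1r.
Qed.

Lemma digit_sum_indic M (y : R) : 0 <= y <= theta -> ~ digit_gt M y ->
  (Num.floor ((theta * y)^-1))%:~R = \sum_(j < M) \1_(digit_gt j) y :> R.
Proof.
move=> yt nM; have /andP[y0 _] := yt.
have lM : (`|dg y| <= M)%N by rewrite leqNgt; apply/negP => /(digit_gtE _ yt).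
rewrite -/(dg y) -(gez0_abs (dg_ge0 y0)) -pmulrn -[in LHS](minn_idPr lM) -sum_ltn_min.
apply: eq_bigr => j _; rewrite indicE; congr (_%:R); congr nat_of_bool.
apply/idP/idP => [h|]; first by rewrite inE; apply/digit_gtE.
by rewrite inE => /(digit_gtE _ yt).
Qed.

(** A digit l <= M is the number of j < M with j < l. While no digit exceeds [M], the digit sum is
    therefore a count of events, as in [chebyshev_indic]. The digits 1 to n use the iterates 0 to n
    - 1. *)
Lemma Ssum_indic n M x : 0 <= x <= theta ->
  (forall k, (k < n)%N -> ~ digit_gt M (iter k T x)) ->
  Ssum theta n x =
  \sum_(p : 'I_n * 'I_M) \1_(iter p.1 T @^-1` digit_gt p.2) x.
Proof.
move=> xt h; rewrite /Ssum big_add1/= big_mkord -(pair_bigA _ (fun (k : 'I_n) (j : 'I_M) =>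
  \1_(iter k T @^-1` digit_gt j) x))/=.
apply: eq_bigr => k _; rewrite /digit /= (@digit_sum_indic M)//; last 2 first.
- exact: iter_Ttheta_itv.
- exact: h.
Qed.

Definition digit_tail j := fine (P (digit_gt j)).
(** The expectation of the minimum of [M] and the first digit, as a sum of tail probabilities. *)
Definition truncated_mean M := \sum_(j < M) digit_tail j.

Lemma digit_tailE j : (m <= j.+1)%N -> digit_tail j = C * lnstep theta (theta * j.+1%:R).
Proof.
move=> mj; have mle : theta * m%:R <= theta * j.+1%:R by rewrite ler_pM2l// ler_nat.
rewrite /digit_tail /digit_gt (_ : Num.min _ _ = (theta * j.+1%:R)^-1).
  by rewrite gauss_prob0E.
apply/min_idPr; rewrite -[leRHS]invrK lef_pV2 ?posrE ?invr_gt0//.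
by rewrite (theta_inv theta_gt0 theta_sq).
Qed.

Lemma digit_tail_le j : (m <= j.+1)%N -> digit_tail j <= C / j.+1%:R.
Proof.
move=> mj; rewrite digit_tailE// ler_pM2l ?gauss_const_gt0//.
exact: lnstep_le.
Qed.

(** For j >= m the tails are C (ln (j + 2) - ln (j + 1)) and telescope; [c] absorbs the earlier
    ones. *)
Lemma truncated_meanE : exists c, forall M, (m <= M)%N ->
  truncated_mean M = c + C * ln M.+1%:R.
Proof.
exists (truncated_mean m - C * ln m.+1%:R) => M /subnKC <-.
elim: (M - m)%N => [|i IHi]; first by rewrite addn0 subrK.
rewrite addnS {1}/truncated_mean big_ord_recr/= -/(truncated_mean (m + i)) IHi.
rewrite digit_tailE; last by rewrite -addnS leq_addr.
rewrite /lnstep -[X in ln (_ + X)]mulr1 -mulrDr natr1.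
by rewrite !lnM ?posrE//; lra.
Qed.

Lemma truncated_mean_ge0 M : 0 <= truncated_mean M.
Proof. by apply: sumr_ge0 => j _; exact: fine_prob_ge0. Qed.

(** By invariance the earlier time can be moved to 0; then [mixing] applies with gap l - k. *)
Let cov_le_ord k i l j : (k <= l)%N ->
  fine (P (iter k T @^-1` digit_gt i `&` iter l T @^-1` digit_gt j)) -
  digit_tail i * digit_tail j <= 2^-1 ^+ (l - k) * digit_tail j.
Proof.
move=> kl; have -> : iter k T @^-1` digit_gt i `&` iter l T @^-1` digit_gt j =
    iter k T @^-1` (digit_gt i `&` iter (l - k) T @^-1` digit_gt j).
  by rewrite preimage_setI; congr (_ `&` _); apply/funext => x;
     rewrite /preimage /= -iterD subnK.
rewrite gauss_prob_iter; last first.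
  by apply: measurableI; [exact: measurable_digit_gt|exact: measurable_iter_digit_gt].
have := mixing theta_gt0 theta_sq m_gt1 (l - k) (measurable_digit_gt j) (minj i).
by move=> /(le_trans (ler_norm _)).
Qed.

Lemma covariance_digit_le k i l j :
  fine (P (iter k T @^-1` digit_gt i `&` iter l T @^-1` digit_gt j)) -
  digit_tail i * digit_tail j <=
  2^-1 ^+ ((k - l) + (l - k)) * (digit_tail i + digit_tail j).
Proof.
have h n : 0 <= (2^-1 : R) ^+ n by rewrite exprn_ge0// invr_ge0.
have pi0 i' : 0 <= digit_tail i' by exact: fine_prob_ge0.
have [kl|lk] := leqP k l.
  rewrite (le_trans (cov_le_ord _ _ kl))// (eqP (kl : k - l == 0)%N) add0n.
  by rewrite ler_wpM2l// lerDr.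
rewrite setIC mulrC (le_trans (cov_le_ord _ _ (ltnW lk)))//.
by rewrite (eqP (ltnW lk : l - k == 0)%N) addn0 ler_wpM2l// lerDl.
Qed.

Lemma measurable_deviation n M (t c : R) :
  measurable [set x : R | t <=
    `|\sum_(p : 'I_n * 'I_M) \1_(iter p.1 T @^-1` digit_gt p.2) x - c|].
Proof.
set f := fun x : R => `|\sum_(p : 'I_n * 'I_M) \1_(iter p.1 T @^-1` digit_gt p.2) x - c|.
suff mf : measurable_fun setT f.
  have -> : [set x | t <= f x] = setT `&` f @^-1` `[t, +oo[%classic.
    by apply/seteqP; split => x; rewrite /= in_itv/= andbT; tauto.
  by apply: mf => //; exact: measurable_itv.
apply: measurableT_comp => //; apply: measurable_funB => //.
apply: measurable_sum => p.
by apply: measurable_indic; exact: measurable_iter_digit_gt.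
Qed.

(** In Chebyshev's bound the majorant of the covariances factors: the sum of 2^-|k - l| over pairs
    of times is at most 3 n, and that of the added tails over pairs of levels is 2 M times the
    truncated mean. *)
Lemma truncated_sum_deviation n M (t : R) : 0 < t ->
  fine (P [set x | t <=
    `|\sum_(p : 'I_n * 'I_M) \1_(iter p.1 T @^-1` digit_gt p.2) x -
      n%:R * truncated_mean M|]) <=
  t ^- 2 * (6 * n%:R * M%:R * truncated_mean M).
Proof.
move=> t0; pose A (p : 'I_n * 'I_M) : set R := iter p.1 T @^-1` digit_gt p.2.
have mA p : measurable (A p) by exact: measurable_iter_digit_gt.
have PA p : fine (P (A p)) = digit_tail p.2.
  by rewrite gauss_prob_iter//; exact: measurable_digit_gt.
have sA : \sum_p fine (P (A p)) = n%:R * truncated_mean M.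
  under eq_bigr do rewrite PA.
  rewrite -(pair_bigA _ (fun (k : 'I_n) (j : 'I_M) => digit_tail j))/=.
  by rewrite sumr_const card_ord mulr_natl.
rewrite -sA.
have mX := measurable_deviation n M t (\sum_p fine (P (A p))).
apply: (le_trans (@chebyshev_indic _ _ _ P _ A t mA t0 mX)).
rewrite ler_pM2l ?invr_gt0 ?exprn_gt0//.
pose d (k l : nat) : R := 2^-1 ^+ ((k - l) + (l - k)).
apply: (@le_trans _ _ (\sum_(p : 'I_n * 'I_M) \sum_(p' : 'I_n * 'I_M)
    d p.1 p'.1 * (digit_tail p.2 + digit_tail p'.2))).
  apply: ler_sum => p _; apply: ler_sum => p' _; rewrite !PA.
  exact: covariance_digit_le.
pose S : R := \sum_(i < M) \sum_(j < M) (digit_tail i + digit_tail j).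
have SE : S = 2 * M%:R * truncated_mean M.
  rewrite /S; under eq_bigr do rewrite big_split/= sumr_const card_ord.
  rewrite big_split/= sumr_const card_ord -/(truncated_mean M).
  by rewrite sumrMnl -/(truncated_mean M) -mulr_natl; lra.
have -> : \sum_(p : 'I_n * 'I_M) \sum_(p' : 'I_n * 'I_M)
    d p.1 p'.1 * (digit_tail p.2 + digit_tail p'.2) =
    (\sum_(k < n) \sum_(l < n) d k l) * S.
  rewrite -(pair_bigA _ (fun (k : 'I_n) (i : 'I_M) => \sum_(p' : 'I_n * 'I_M)
     d k p'.1 * (digit_tail i + digit_tail p'.2)))/=.
  rewrite mulr_suml; apply: eq_bigr => k _.
  rewrite mulr_suml /S.
  under eq_bigr do rewrite -(pair_bigA _ (fun (l : 'I_n) (j : 'I_M) =>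
     d k l * (digit_tail _ + digit_tail j)))/=.
  rewrite exchange_big/=; apply: eq_bigr => l _.
  by rewrite mulr_sumr; apply: eq_bigr => i _; rewrite mulr_sumr.
rewrite SE.
have dn : \sum_(k < n) \sum_(l < n) d k l <= 3 * n%:R.
  rewrite mulrC mulr_natl -[X in _ <= _ *+ X]card_ord -sumr_const.
  by apply: ler_sum => k _; exact: sum_half_dist_le.
have S0 : 0 <= 2 * M%:R * truncated_mean M.
  by rewrite !mulr_ge0// truncated_mean_ge0.
by have := ler_wpM2r S0 dn; lra.
Qed.

Lemma large_digit_prob n M : (m <= M.+1)%N ->
  let U := [set x : R | exists2 k, (k < n)%N & digit_gt M (iter k T x)] in
  measurable U /\ fine (P U) <= n%:R * (C / M.+1%:R).
Proof.
move=> mM; elim: n => [|n [mU IH]] /=.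
  rewrite (_ : [set x | _] = set0); last by apply/seteqP; split => // x [].
  by rewrite measure0 mul0r.
rewrite (_ : [set x | _] = [set x : R | exists2 k, (k < n)%N & digit_gt M (iter k T x)]
    `|` iter n T @^-1` digit_gt M); last first.
  apply/seteqP; split => x.
    move=> [k]; rewrite ltnS leq_eqVlt => /predU1P[->|kn] h; [by right|].
    by left; exists k.
  by move=> [[k kn h]|h]; [exists k => //; exact: ltnW|exists n].
have mn := measurable_iter_digit_gt n M.
split; first exact: measurableU.
rewrite -natr1 mulrDl mul1r.
apply: le_trans (fine_probU2_le P mU mn) _.
rewrite lerD// gauss_prob_iter; last exact: measurable_digit_gt.
exact: digit_tail_le.
Qed.

End digit_sums.

(** * Convergence in probability of the normalized digit sums *)

Section weak_law.
Variables (R : realType) (theta : R) (m : nat).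
Hypotheses (theta_gt0 : 0 < theta) (theta_sq : theta ^+ 2 = m%:R^-1).
Hypothesis m_gt1 : (1 < m)%N.
Local Notation T := (Ttheta theta).
Local Notation C := (gauss_const theta).
Local Notation P := (gauss_prob theta_gt0 theta_sq).
Local Notation tmean := (truncated_mean theta_gt0 theta_sq).

(** The densities agree: theta/(1 + theta x) = 1/(theta m + x), because theta m = 1/theta. *)
Lemma gamma_thetaE (A : set R) : measurable A -> gamma_theta theta A = P A.
Proof.
move=> mA; rewrite /gamma_theta -/C /gauss_prob /gauss_measure -branch_measureI.
rewrite /branch_measure /density_measure.
have mAt : measurable (A `&` `[0, theta]%classic) by exact: measurableI.
transitivity (\int[@lebesgue_measure R]_(x in A `&` `[0%R, theta]%classic)
    (C%:E * (theta / (1 + theta * x))%:E))%E.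
  rewrite ge0_integralZl_EFin//.
  - move=> x [_ /=]; rewrite in_itv/= lee_fin => /andP[x0 _].
    by rewrite divr_ge0 ?addr_ge0 ?mulr_ge0// ltW.
  - apply/measurable_EFinP; apply: measurable_funTS; apply: measurable_funM => //.
    apply: (measurableT_comp (@measurable_invr R)); exact: measurable_funD.
  - exact: gauss_const_ge0.
apply: eq_integral => x /[!inE] -[_ /=]; rewrite in_itv/= => /andP[x0 xt].
rewrite -EFinM /branch_density x0 xt/= ltNge x0/= addn0; congr (_%:E).
congr (_ * _); rewrite -(theta_inv theta_gt0 theta_sq); field.
have : 0 < 1 + theta * x by rewrite ltr_pwDl// mulr_ge0// ltW.
by rewrite (mulrC theta) => /lt0r_neq0 ->; rewrite (lt0r_neq0 theta_gt0).
Qed.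

Lemma measurable_Ssum n : measurable_fun setT (Ssum theta n).
Proof.
apply: measurable_sum => k.
apply: (measurableT_comp (@measurable_floor R)).
apply: (measurableT_comp (@measurable_invr R)).
by apply: measurable_funM => //; exact: measurable_iter_Ttheta.
Qed.

Variable eps : R.
Hypothesis eps_gt0 : 0 < eps.

Let bad n := [set x : R | 0 <= x <= theta /\
  eps < `| Ssum theta n x / (n%:R * ln n%:R) - (ln (1 + theta ^+ 2))^-1 | ].

Lemma measurable_bad n : measurable (bad n).
Proof.
have -> : bad n = `[0, theta]%classic `&` (fun x => `| Ssum theta n x / (n%:R * ln n%:R) - C|)
    @^-1` `]eps, +oo[%classic.
  by apply/seteqP; split => x; rewrite /bad /= !in_itv/= andbT.
apply: measurableI; first exact: measurable_itv.
rewrite -[X in measurable X]setTI.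
suff : measurable_fun setT (fun x => `| Ssum theta n x / (n%:R * ln n%:R) - C|).
  by apply => //; exact: measurable_itv.
apply: measurableT_comp => //; apply: measurable_funB => //.
by apply: measurable_funM => //; exact: measurable_Ssum.
Qed.

(** A bad point either has a digit above [M] among the first [n], or its truncated sum deviates from
    its mean by at least (eps/2) n ln n, the other eps/2 being taken up by the bias of the mean. *)
Lemma bad_prob_le n M : (0 < n)%N -> (m <= M.+1)%N -> 0 < ln n%:R :> R ->
  `|tmean M / ln n%:R - C| <= eps / 2 ->
  fine (P (bad n)) <= n%:R * (C / M.+1%:R) +
    (eps / 2 * (n%:R * ln n%:R)) ^- 2 * (6 * n%:R * M%:R * tmean M).
Proof.
move=> n0 mM ln0 muC.
have nl0 : 0 < n%:R * ln n%:R :> R by rewrite mulr_gt0// ltr0n.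
set t := eps / 2 * _; have t0 : 0 < t by rewrite mulr_gt0// divr_gt0.
have [mU PU] := large_digit_prob theta_gt0 theta_sq n mM.
set U := [set x | _] in mU PU.
set V := [set x | t <= `|\sum_(p : 'I_n * 'I_M) \1_(iter p.1 T @^-1` digit_gt theta p.2) x -
      n%:R * tmean M|].
have PV := truncated_sum_deviation theta_gt0 theta_sq m_gt1 n M t0.
have mV : measurable V by exact: measurable_deviation.
apply: (@le_trans _ _ (fine (P (U `|` V)))).
  apply: le_fine_prob; [exact: measurable_bad|exact: measurableU|].
  move=> x [xt xbad]; have [Ux|nU] := pselect (U x); [by left|right].
  rewrite /V /= -Ssum_indic//; last first.
    by move=> k kn h; apply: nU; exists k.
  set S := Ssum theta n x in xbad *.
  have -> : S - n%:R * tmean M = (n%:R * ln n%:R) *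
      ((S / (n%:R * ln n%:R) - C) - (tmean M / ln n%:R - C)).
    by field; rewrite !gt_eqF// ltr0n.
  rewrite normrM (gtr0_norm nl0) /t mulrC ler_pM2l//.
  apply: le_trans (lerB_dist _ _); rewrite -/C in xbad; lra.
by apply: le_trans (fine_probU2_le P mU mV) _; exact: lerD.
Qed.

(** ln (n K + 1) lies between ln n and ln n + ln (K + 1), so the error is bounded uniformly in
    [n]. *)
Lemma truncated_mean_log (K : nat) : (0 < K)%N -> exists D, forall n, (m <= n)%N ->
  `|tmean (n * K) - C * ln n%:R| <= D.
Proof.
move=> K0; have [c cE] := truncated_meanE theta_gt0 theta_sq.
exists (`|c| + C * ln K.+1%:R) => n mn.
have n0 : (0 < n)%N by rewrite (leq_trans _ mn)// ltnW.
rewrite cE; last by rewrite (leq_trans mn)// leq_pmulr.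
rewrite -addrA -mulrBr (le_trans (ler_normD _ _))// lerD2l.
have lo : ln n%:R <= ln (n * K).+1%:R :> R.
  by rewrite ler_ln ?posrE ?ltr0n// ler_nat ltnW// ltnS leq_pmulr.
have hi : ln (n * K).+1%:R <= ln n%:R + ln K.+1%:R :> R.
  rewrite -lnM ?posrE ?ltr0n// -natrM ler_ln ?posrE ?ltr0n ?muln_gt0 ?n0//.
  by rewrite ler_nat mulnS; lia.
rewrite ger0_norm; last by rewrite mulr_ge0 ?gauss_const_ge0// subr_ge0.
by rewrite ler_wpM2l ?gauss_const_ge0// lerBlDl.
Qed.

Lemma bad_prob_small (eta : R) : 0 < eta ->
  exists N, forall n, (N <= n)%N -> fine (P (bad n)) <= eta.
Proof.
move=> eta0; have C0 := gauss_const_gt0 theta_gt0.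
(* With M = n K the probability of a large digit is at most C/K, hence at most eta/2. *)
pose K := (Num.trunc (2 * C / eta)).+1.
have [D DE] := @truncated_mean_log K isT.
have KC : C / K%:R <= eta / 2.
  have : 2 * C / eta < K%:R by rewrite truncnS_gt.
  rewrite ltr_pdivrMr// => h; rewrite ler_pdivrMr ?ltr0n//; lra.
(* With M = n K the Chebyshev term is at most A / ln n: here 24 is 6 divided by (1/2)^2, and C +
   eps/2 bounds the truncated mean divided by ln n. *)
pose A : R := 24 * K%:R / eps ^+ 2 * (C + eps / 2).
have A0 : 0 < A.
  by rewrite mulr_gt0 ?divr_gt0 ?mulr_gt0 ?exprn_gt0 ?addr_gt0 ?divr_gt0// ltr0n.
(* Once ln n >= L, the three summands give in turn ln n > 0, a bias of the mean of at most eps/2,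
   and a Chebyshev term of at most eta/2. *)
pose L : R := 1 + 2 * `|D| / eps + 2 * A / eta.
have d1 : 0 <= 2 * `|D| / eps by rewrite divr_ge0 ?mulr_ge0// ltW.
have d2 : 0 < 2 * A / eta by rewrite divr_gt0// mulr_gt0.
have L1 : 1 <= L by rewrite /L; lra.
have L2 : 2 * `|D| / eps <= L by rewrite /L; lra.
have L3 : 2 * A / eta <= L by rewrite /L; lra.
exists (maxn m (Num.trunc (expR L)).+1) => n; rewrite geq_max => /andP[mn Ln].
have n0 : (0 < n)%N by rewrite (leq_trans _ mn)// ltnW.
have nR : 0 < n%:R :> R by rewrite ltr0n.
have Lln : L <= ln n%:R.
  rewrite -[leLHS]expRK ler_ln ?posrE ?expR_gt0//.
  by rewrite (le_trans (ltW (truncnS_gt _)))// ler_nat.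
have ln0 : 0 < ln n%:R :> R by rewrite (lt_le_trans _ Lln)// (lt_le_trans ltr01).
have Dn := DE _ mn.
have muC : `|tmean (n * K) / ln n%:R - C| <= eps / 2.
  have -> : tmean (n * K) / ln n%:R - C = (tmean (n * K) - C * ln n%:R) / ln n%:R.
    by field; rewrite gt_eqF.
  rewrite normrM normfV (gtr0_norm ln0) ler_pdivrMr//.
  apply: (le_trans Dn); apply: (le_trans (ler_norm _)).
  have := le_trans L2 Lln; rewrite ler_pdivrMr// => h; lra.
have mM : (m <= (n * K).+1)%N.
  by rewrite (leq_trans mn)// ltnW// ltnS leq_pmulr.
apply: (le_trans (bad_prob_le n0 mM ln0 muC)).
have t1 : n%:R * (C / (n * K).+1%:R) <= eta / 2.
  apply: le_trans KC; rewrite mulrCA ler_wpM2l ?(ltW C0)//.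
  rewrite ler_pdivrMr ?ltr0n// mulrC ler_pdivlMr ?ltr0n// -natrM ler_nat.
  exact: leqW.
set mu := tmean _ in muC *.
have mu_le : mu / ln n%:R <= C + eps / 2.
  by move: muC; rewrite ler_norml => /andP[_]; lra.
have t2 : (eps / 2 * (n%:R * ln n%:R)) ^- 2 * (6 * n%:R * (n * K)%:R * mu) <= eta / 2.
  have -> : (eps / 2 * (n%:R * ln n%:R)) ^- 2 * (6 * n%:R * (n * K)%:R * mu) =
    24 * K%:R / eps ^+ 2 * (mu / ln n%:R) / ln n%:R.
    by rewrite natrM; field; rewrite !gt_eqF.
  rewrite ler_pdivrMr//.
  apply: (@le_trans _ _ A).
    by rewrite /A ler_wpM2l// divr_ge0 ?mulr_ge0 ?exprn_ge0// ltW.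
  have := le_trans L3 Lln; rewrite ler_pdivrMr// => h; lra.
by rewrite (splitr eta) lerD.
Qed.

End weak_law.

Unset Implicit Arguments.

Theorem theorem1p3 (R : realType) (theta : R) (m : nat)
  (Hm : (0 < m)%N)
  (Htheta : 0 < theta < 1)
  (Hirr : ~ exists q : rat, theta = ratr q)
  (Hsq : theta ^+ 2 = (m%:R)^-1)
  (eps : R) (Heps : 0 < eps) :
  (fun n : nat => gamma_theta theta
     [set x : R | 0 <= x <= theta /\
        eps < `| Ssum theta n x / (n%:R * ln n%:R) - (ln (1 + theta ^+ 2))^-1 | ])
  @ \oo --> 0%E.
Proof.
have /andP[theta_gt0 theta_lt1] := Htheta.
(* theta < 1 excludes m = 1; the oscillation bound 1/2 behind [mixing] relies on m >= 2. *)
have m_gt1 : (1 < m)%N.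
  rewrite ltnNge; apply/negP => m1; move: Hsq.
  have -> : m = 1%N by apply/eqP; rewrite eqn_leq m1.
  rewrite invr1 => sq1.
  have : theta ^+ 2 < 1 by rewrite exprn_ilt1// ltW.
  by rewrite sq1 ltxx.
pose P := gauss_prob theta_gt0 Hsq.
pose bad n := [set x : R | 0 <= x <= theta /\
  eps < `| Ssum theta n x / (n%:R * ln n%:R) - (ln (1 + theta ^+ 2))^-1 | ].
rewrite (_ : (fun n => _) = EFin \o (fun n => fine (P (bad n)))); last first.
  apply/funext => n; have mb := measurable_bad theta eps n.
  by rewrite (gamma_thetaE theta_gt0 Hsq)//= fineK// fin_num_measure.
apply: cvg_EFin; first by near=> n.
apply/cvgrPdist_le => e e0.
have [N PN] := bad_prob_small theta_gt0 Hsq m_gt1 Heps e0.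
exists N => // n /= Nn; rewrite sub0r normrN ger0_norm ?fine_prob_ge0//.
exact: PN.
Unshelve. all: by end_near.
Qed.
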